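(* Let $(\mathbb{X},d_{\mathbb{X}})$ be a Polish metric space with bounded diameter and let $$\tilde P_1=\sum_{j\ge1}J_j^{(1)}\delta_{X_j^{(1)}},\qquad \tilde P_2=\sum_{j\ge1}J_j^{(2)}\delta_{X_j^{(2)}}$$ be two discrete random probabilities on $\mathbb{X}$ (with finitely or infinitely many atoms) such that: (a) the jumps are independent of the atoms, i.e. $(J_j^{(i)})_{j\ge1}$ is independent of $(X_j^{(i)})_{j\ge1}$, for $i=1,2$; (b) the atoms are i.i.d. from base distributions $P_1,P_2\in\mathcal{P}(\mathbb{X})$ respectively, i.e. $(X_j^{(i)})_{j\ge1}$ are i.i.d. with law $P_i$, for $i=1,2$; (c) the jump distributions coincide, i.e. $(J_j^{(1)})_{j\ge1}$ and $(J_j^{(2)})_{j\ge1}$ have the same law. Then $$\mathcal{W}_{\mathcal{W}}(\tilde P_1,\tilde P_2)=d_{\mathrm{Lip}}(\tilde P_1,\tilde P_2)=\mathcal{W}(P_1,P_2).$$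
   Context: $(\mathbb{X},d_{\mathbb{X}})$ is a complete separable metric space with $\sup_{x,y}d_{\mathbb{X}}(x,y)<\infty$. $\mathcal{P}(\mathbb{X})$ is the space of Borel probability measures on $\mathbb{X}$ with the weak topology, and $\mathcal{P}(\mathcal{P}(\mathbb{X}))$ the space of Borel probability measures on it. A random probability is a random element of $\mathcal{P}(\mathbb{X})$; in particular the jumps are nonnegative and sum to 1 almost surely. $P(f)=\int f\,\mathrm{d}P$, and $\mathcal{L}(\cdot)$ denotes the law. $\mathcal{W}$ denotes the Wasserstein distance of order 1: $\mathcal{W}(P_1,P_2)=\inf_{\gamma\in\Gamma(P_1,P_2)}\mathbb{E}_{(Y_1,Y_2)\sim\gamma}(d(Y_1,Y_2))$, with $\Gamma(P_1,P_2)$ the set of couplings, on $\mathbb{X}$ with $d=d_{\mathbb{X}}$ or on $\mathbb{R}$ with the usual distance. For $\mathbb{Q}_1,\mathbb{Q}_2\in\mathcal{P}(\mathcal{P}(\mathbb{X}))$, the Wasserstein over Wasserstein distance is $\mathcal{W}_{\mathcal{W}}(\mathbb{Q}_1,\mathbb{Q}_2)=\inf_{\gamma\in\Gamma(\mathbb{Q}_1,\mathbb{Q}_2)}\mathbb{E}_{(\tilde P_1,\tilde P_2)\sim\gamma}(\mathcal{W}(\tilde P_1,\tilde P_2))$, and the Lipschitz HIPM is $d_{\mathrm{Lip}}(\mathbb{Q}_1,\mathbb{Q}_2)=\sup_{f}\mathcal{W}(\mathcal{L}(\tilde P_1(f)),\mathcal{L}(\tilde P_2(f)))$, where $\tilde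 P_i\sim\mathbb{Q}_i$ and $f$ ranges over the 1-Lipschitz functions $\mathbb{X}\to\mathbb{R}$. For random probabilities, $\mathcal{W}_{\mathcal{W}}(\tilde P_1,\tilde P_2)$ and $d_{\mathrm{Lip}}(\tilde P_1,\tilde P_2)$ mean the distances between their laws. *)

(* Defs.v *)
From HB Require Import structures.
From mathcomp Require Import all_boot all_order all_algebra finmap.
From mathcomp Require Import all_classical all_reals all_analysis.
From mathcomp Require Import measurable_realfun.
Import Order.TTheory GRing.Theory Num.Theory.
Import numFieldNormedType.Exports.

Set Implicit Arguments.
Unset Strict Implicit.
Unset Printing Implicit Defensive.

Local Open Scope classical_set_scope.
Local Open Scope ring_scope.

#[short(type="completeMetricType")]
HB.structure Definition CompleteMetric (R : numDomainType) :=
  {T of Complete T & Metric R T}.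

Definition separable (T : topologicalType) :=
  exists2 D : set T, countable D & dense D.

Definition bounded_diameter (R : realType) (X : metricType R) :=
  exists M : R, forall x y : X, mdist x y <= M.

Definition borel (T : ptopologicalType) := g_sigma_algebraType (@open T).

Section random_probabilities.
Context (R : realType) (X : completeMetricType R).

Definition bounded_continuous :=
  {f : X -> R | continuous f /\ [bounded f x | x in [set: X]]}.

HB.instance Definition _ := gen_eqMixin bounded_continuous.

Definition pairing (P : probability (borel X) R) :
    prod_topology (fun _ : bounded_continuous => R) :=
  fun f => \int[P]_x (sval f x).

(* The weak topology on P(X): the coarsest one making P |-> P(f) continuous for
   every bounded continuous f. Elements of [probability _ R] may differ off the
   measurable sets; such copies have the same open neighbourhoods, so that they
   are not separated by the Borel sets either. *)
Definition weak_prob := initial_topology pairing.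

Definition borel_prob := borel weak_prob.

End random_probabilities.

Section wasserstein.
Context (R : realType) d (T : measurableType d).
Local Open Scope ereal_scope.

(* The marginals are plain set functions so that the image of a probability
   under a map can be used without carrying a measurability proof. Couplings
   live on the product sigma-algebra, which for the separable spaces considered
   here is the Borel sigma-algebra of the product topology. *)
Definition coupling (mu nu : set T -> \bar R) : set (probability (T * T)%type R) :=
  [set g | forall A, measurable A ->
    pushforward g fst A = mu A /\ pushforward g snd A = nu A].

Definition wasserstein (c : T -> T -> \bar R) (mu nu : set T -> \bar R) : \bar R :=
  ereal_inf [set \int[g]_z c z.1 z.2 | g in coupling mu nu].

End wasserstein.

Section distances.
Context (R : realType) (X : completeMetricType R).
Local Open Scope ereal_scope.

Definition W (P1 P2 : probability (borel X) R) : \bar R :=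
  wasserstein (fun x y : borel X => (mdist (x : X) (y : X))%:E) P1 P2.

Definition W_real (mu nu : set R -> \bar R) : \bar R :=
  wasserstein (fun x y : R => `|x - y|%:E) mu nu.

Definition W_W (Q1 Q2 : probability (borel_prob X) R) : \bar R :=
  wasserstein (fun P1 P2 : borel_prob X => W P1 P2) Q1 Q2.

Definition lip1 (f : X -> R) := forall x y, (`|f x - f y| <= mdist x y)%R.

Definition law_of_mean (Q : probability (borel_prob X) R) (f : X -> R) :
    set R -> \bar R :=
  pushforward Q
    (fun P : borel_prob X => (\int[P : probability (borel X) R]_x (f x))%R).

Definition d_Lip (Q1 Q2 : probability (borel_prob X) R) : \bar R :=
  ereal_sup [set W_real (law_of_mean Q1 f) (law_of_mean Q2 f) | f in lip1].

End distances.

Lemma lip1_bounded_continuous (R : realType) (X : completeMetricType R)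
    (f : X -> R) : bounded_diameter X -> lip1 f ->
  continuous f /\ [bounded f x | x in [set: X]].
Proof.
move=> [M XM] f1; split.
  move=> x; apply/cvgrPdist_lt => e e0.
  apply/nbhs_ballP; exists e => //= y; rewrite ballEmdist/= => xye.
  exact: le_lt_trans (f1 x y) xye.
exists (`|f point| + M); split; first exact: num_real.
move=> N MN x _ /=; apply/ltW/le_lt_trans/MN.
rewrite -[f x](subrK (f point)) addrC.
by rewrite (le_trans (ler_normD _ _))// lerD2l (le_trans (f1 _ _)).
Qed.

(* Consequently [law_of_mean Q f] is a genuine probability for the f ranged over in
   [d_Lip], as soon as the diameter of X is bounded. *)
Lemma measurable_mean (R : realType) (X : completeMetricType R)
    (f : X -> R) : bounded_diameter X -> lip1 f ->
  measurable_fun [set: borel_prob X]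
    (fun P : borel_prob X => \int[P : probability (borel X) R]_x f x).
Proof.
move=> Xb f1; pose F : bounded_continuous X :=
  exist _ f (lip1_bounded_continuous Xb f1).
apply: (measurability _ (RGenOpens.measurableE R)).
move=> _ [_ [a [b ->]] <-]; rewrite setTI; apply: sub_sigma_algebra => /=.
exists ((fun g : prod_topology (fun _ : bounded_continuous X => R) => g F) @^-1` `]a, b[) => //.
apply: open_comp; last exact: interval_open.
move=> g _; exact: (@proj_continuous (bounded_continuous X) (fun=> R) F g).
Qed.

(* Countable families indexed by I (finite or infinite) are random elements of
   T^I with its product sigma-algebra. *)
Section families.
Context d (T : measurableType d) (I : countType).

Definition cylinders : set (set (I -> T)) :=
  [set (fun x => x i) @^-1` A | i in [set: I] & A in @measurable d T].

Definition family_space := g_sigma_algebraType cylinders.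

Definition joint (Omega : Type) (Y : I -> Omega -> T) : Omega -> family_space :=
  fun w i => Y i w.

End families.

Section atoms_and_jumps.
Context (R : realType) (X : completeMetricType R) (I : countType).
Context d (Omega : measurableType d) (mu : probability Omega R).
Local Open Scope ereal_scope.

Definition indep_families d1 (T1 : measurableType d1) d2 (T2 : measurableType d2)
    (Y : I -> {mfun Omega >-> T1}) (Z : I -> {mfun Omega >-> T2}) :=
  forall (A : set (family_space T1 I)) (B : set (family_space T2 I)),
    measurable A -> measurable B ->
    mu (joint Y @^-1` A `&` joint Z @^-1` B) =
    mu (joint Y @^-1` A) * mu (joint Z @^-1` B).

Definition iid d1 (T1 : measurableType d1) (Y : I -> {mfun Omega >-> T1})
    (P : probability T1 R) :=
  (forall (F : {fset I}) (A : I -> set T1), (forall i, measurable (A i)) ->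
     mu (\bigcap_(i in [set` F]) (Y i @^-1` A i)) =
     \prod_(i <- F) mu (Y i @^-1` A i)) /\
  (forall i A, measurable A -> distribution mu (Y i) A = P A).

Definition discrete_random_probability (Pt : {mfun Omega >-> borel_prob X})
    (J : I -> {mfun Omega >-> R}) (Y : I -> {mfun Omega >-> borel X}) :=
  {ae mu, forall w, (forall j, (0 <= J j w)%R) /\
    forall A : set (borel X), measurable A ->
      (Pt w : probability (borel X) R) A =
      \esum_(j in [set: I]) ((J j w)%:E * \d_(Y j w) A)}.

End atoms_and_jumps.

Definition same_joint_law (R : realType) (I : countType) d (T : measurableType d)
    d1 (Omega1 : measurableType d1) (mu1 : probability Omega1 R)
    d2 (Omega2 : measurableType d2) (mu2 : probability Omega2 R)
    (Y1 : I -> {mfun Omega1 >-> T}) (Y2 : I -> {mfun Omega2 >-> T}) :=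
  forall A : set (family_space T I), measurable A ->
    pushforward mu1 (joint Y1) A = pushforward mu2 (joint Y2) A.

(* Main.v *)
From HB Require Import structures.
Require Import Defs.
From mathcomp Require Import all_boot all_order all_algebra finmap.
From mathcomp Require Import all_classical all_reals all_analysis.
From mathcomp Require Import measurable_realfun ring lra.
Import Order.TTheory GRing.Theory Num.Theory.
Import numFieldNormedType.Exports.

(** The three distances are compared through the cycle
      d_Lip <= W_W <= W(P1, P2) <= d_Lip.

    d_Lip <= W_W ([d_Lip_le_W_W]).  A coupling of the two laws on P(X) is
    pushed forward by (P, P') |-> (P(f), P'(f)); for a 1-Lipschitz f one has
    |P(f) - P'(f)| <= W(P, P') ([mean_gap_le_W]).

    W(P1, P2) <= d_Lip ([W_le_d_Lip]).  Since the jumps are independent of the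
    atoms and sum to one, the mean measure of each random probability is its
    base measure: E[Pt(f)] = P(f) ([expect_mean]).  A Wasserstein distance on
    the line dominates the difference of the means, whence
    P1(f) - P2(f) <= d_Lip for every 1-Lipschitz f, and Kantorovich duality
    ([kantorovich_rubinstein]) turns this into a bound on W(P1, P2).

    W_W <= W(P1, P2) ([W_W_le_W]).  The natural coupling uses the same jumps
    on both sides and i.i.d. pairs of atoms drawn from a nearly optimal
    coupling of P1 and P2.  As the infimum defining W_W need only be
    approached, it suffices to do this for a finite set F of indices carrying
    almost all of the expected mass and up to a small discretization error:
    jumps are rounded to a grid, atoms are replaced by the cell of a finite
    partition of X that contains them, and the product measure on
    Omega1 * Omega2 is reweighted by a density which only depends on these
    finitely many labels ([density_coupling], [synchronous_density]).  The
    density forces the rounded jumps to agree and gives the pairs of cells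
    the law of a nearly optimal finite transport plan, independently over F,
    while its partial averages are equal to 1, so that the marginals are
    exactly mu1 and mu2.  Under this measure the cost W(Pt1, Pt2) is bounded by a
    function of the labels ([discrete_gap] and Kantorovich duality), whose
    expectation is a finite sum ([W_W_le_transport]).

    Kantorovich duality itself is obtained from the same reweighting applied
    to X * X.  On the finitely many cells, duality for the finite transport
    problem ([transport_duality]) is an instance of the Hahn-Banach theorem
    ([hahn_banach_span]), and its dual solution is turned into a 1-Lipschitz
    function on X by an infimal convolution ([cell_transport]). *)

Set Implicit Arguments.
Unset Strict Implicit.
Unset Printing Implicit Defensive.
Local Open Scope classical_set_scope.
Local Open Scope ring_scope.

(** * Sublinear functionals on the span of finitely many vectors *)

Section hahn_banach.
Context (R : realType) (V : lmodType R).
Implicit Types (p q : V -> R) (v x y : V).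

Definition sublinear p :=
  (forall x y, p (x + y) <= p x + p y) /\
  (forall t x, 0 <= t -> p (t *: x) = t * p x).

(** For a sublinear functional, p v + p (- v) is always nonnegative; when it
    vanishes, p is linear in the direction v (see [flat_additive]). *)
Definition flat p v := p v + p (- v) <= 0.

(** The largest sublinear functional q <= p with q (- v) <= - p v. *)
Definition flatten_at p v x := inf [set p (x + t *: v) - t * p v | t in [set t | 0 <= t]].

Lemma sublinear0 p : sublinear p -> p 0 = 0.
Proof. by move=> [_ pZ]; rewrite -(scale0r (0 : V)) pZ// mul0r. Qed.

Lemma flatten_at_bound p v x t : sublinear p -> 0 <= t ->
  - p (- x) <= p (x + t *: v) - t * p v.
Proof.
move=> [pD pZ] t0; rewrite -pZ// lerBrDr addrC lerBlDr.
by have := pD (x + t *: v) (- x); rewrite addrAC subrr add0r.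
Qed.

Lemma flatten_at_le p v x t : sublinear p -> 0 <= t ->
  flatten_at p v x <= p (x + t *: v) - t * p v.
Proof.
move=> sp t0; apply: ge_inf; last by exists t.
by exists (- p (- x)) => _ [s /= s0 <-]; exact: flatten_at_bound.
Qed.

Lemma le_flatten_at p v x z :
  (forall t, 0 <= t -> z <= p (x + t *: v) - t * p v) -> z <= flatten_at p v x.
Proof.
move=> zp; apply: lb_le_inf; last by move=> _ [t /= t0 <-]; exact: zp.
by exists (p (x + 0 *: v) - 0 * p v), 0 => /=.
Qed.

Lemma flatten_at_dominated p v x : sublinear p -> flatten_at p v x <= p x.
Proof.
by move=> sp; rewrite (le_trans (flatten_at_le v x sp (lexx 0)))// scale0r mul0r addr0 subr0.
Qed.

Lemma sublinear_flatten_at p v : sublinear p -> sublinear (flatten_at p v).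
Proof.
move=> sp; have [pD pZ] := sp; split.
  move=> x y; rewrite -lerBlDr; apply: le_flatten_at => t t0.
  rewrite lerBlDl -lerBlDr; apply: le_flatten_at => s s0.
  rewrite lerBlDr.
  rewrite (le_trans (flatten_at_le v _ sp (addr_ge0 s0 t0)))//.
  have := pD (y + s *: v) (x + t *: v).
  rewrite scalerDl (_ : y + _ + _ = x + y + (s *: v + t *: v)); last first.
    by rewrite addrACA (addrC y).
  lra.
move=> t x; rewrite le_eqVlt => /predU1P[<-|t0].
  rewrite scale0r mul0r; apply/eqP; rewrite eq_le; apply/andP; split.
    by rewrite (le_trans (flatten_at_dominated v 0 sp))// sublinear0.
  apply: le_flatten_at => s s0; rewrite add0r pZ//; lra.
have h (s : R) : 0 <= s -> p (t *: x + s *: v) - s * p v =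
    t * (p (x + (s / t) *: v) - (s / t) * p v).
  move=> s0; rewrite mulrBr -(pZ t) ?ltW// scalerDr scalerA mulrCA divff ?gt_eqF// mulr1.
  by rewrite mulrA mulrCA divff ?gt_eqF// mulr1.
apply/eqP; rewrite eq_le; apply/andP; split.
  rewrite mulrC -ler_pdivrMr//; apply: le_flatten_at => s s0.
  rewrite ler_pdivrMr//.
  have ts0 : 0 <= t * s by rewrite mulr_ge0// ltW.
  have := flatten_at_le v (t *: x) sp ts0.
  by rewrite h// (mulrC t s) mulfK ?gt_eqF// (mulrC _ t).
apply: le_flatten_at => s s0; rewrite h// ler_pM2l//.
by apply: flatten_at_le => //; rewrite divr_ge0// ltW.
Qed.

Lemma flatten_atN p v : sublinear p -> flatten_at p v (- v) <= - p v.
Proof.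
move=> sp; rewrite (le_trans (flatten_at_le v _ sp ler01))//.
by rewrite scale1r addNr sublinear0// mul1r sub0r.
Qed.

Lemma flat_flatten_at p v : sublinear p -> flat (flatten_at p v) v.
Proof.
move=> sp; rewrite /flat.
have := flatten_at_dominated v v sp; have := flatten_atN v sp; lra.
Qed.

(** The vectors can be treated one after the other: flatness at v is
    inherited by every sublinear functional below, hence survives the later
    flattenings. *)
Lemma sublinear_flatten_seq p (s : seq V) : sublinear p ->
  exists q, [/\ sublinear q, forall x, q x <= p x & {in s, forall v, flat q v}].
Proof.
elim: s p => [p sp|v s IH p sp]; first by exists p.
have [q [sq qp qs]] := IH _ (sublinear_flatten_at v sp).
exists q; split => // [x|w].
  by rewrite (le_trans (qp x))// flatten_at_dominated.
rewrite inE => /predU1P[->|]; last exact: qs.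
rewrite /flat (le_trans _ (flat_flatten_at v sp))//; exact: lerD.
Qed.

Lemma flat_additive q v x t : sublinear q -> flat q v -> q (x + t *: v) = q x + t * q v.
Proof.
move=> sq qv; have [qD qZ] := sq.
have qN : q (- v) = - q v.
  have := qD v (- v); rewrite subrr sublinear0//; move: qv; rewrite /flat; lra.
have qtZ s : q (s *: v) = s * q v.
  have [s0|s0] := leP 0 s; first exact: qZ.
  have -> : s *: v = (- s) *: (- v) by rewrite scalerN scaleNr opprK.
  by rewrite qZ ?oppr_ge0 ?ltW// qN mulrNN.
have := qD x (t *: v); have := qD (x + t *: v) (- (t *: v)).
rewrite addrK -scaleNr !qtZ; lra.
Qed.

(** Flattening at [x0] first pins the value at [x0], because
    q (- x0) <= - p x0 forces q x0 >= p x0; flattening along [s] then makes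
    the functional linear on the span of [s]. *)
Lemma hahn_banach_span p (s : seq V) x0 : sublinear p ->
  exists q, [/\ sublinear q, forall x, q x <= p x, q x0 = p x0 &
    forall v, v \in s -> forall x t, q (x + t *: v) = q x + t * q v].
Proof.
move=> sp; have sp0 := sublinear_flatten_at x0 sp.
have [q [sq qp qs]] := sublinear_flatten_seq s sp0.
exists q; split => //.
- by move=> x; rewrite (le_trans (qp x))// flatten_at_dominated.
- apply/eqP; rewrite eq_le (le_trans (qp x0)) ?flatten_at_dominated//=.
  have := qp (- x0); have := flatten_atN x0 sp.
  have [qD _] := sq; have := qD x0 (- x0); rewrite subrr sublinear0//; lra.
- by move=> v vs x t; apply: flat_additive => //; exact: qs.
Qed.

End hahn_banach.

(** * Duality for finite transport problems *)

Section transport_duality.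
Context (R : realType) (T1 T2 : finType) (p : T1 -> R) (q : T2 -> R).
Hypotheses (p0 : forall a, 0 <= p a) (q0 : forall b, 0 <= q b).
Hypotheses (p1 : \sum_a p a = 1) (q1 : \sum_b q b = 1).

Let V := {ffun T1 * T2 -> R^o}.

Definition dual_feasible (h : V) (f : T1 -> R) (g : T2 -> R) :=
  forall a b, h (a, b) <= f a + g b.

Definition dual_cost (f : T1 -> R) (g : T2 -> R) := \sum_a f a * p a + \sum_b g b * q b.

(** The least cost of a pair of prices (f, g) whose sum dominates h.  It is
    sublinear in h, and the linear functionals below it are exactly the
    integrals of h against transport plans from p to q. *)
Definition dual_value (h : V) : R :=
  inf [set r | exists f g, dual_feasible h f g /\ r = dual_cost f g].

Lemma sum_product_weight (f : T1 -> R) (g : T2 -> R) :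
  \sum_a \sum_b (f a + g b) * (p a * q b) = dual_cost f g.
Proof.
under eq_bigr do under eq_bigr do rewrite mulrDl.
under eq_bigr do rewrite big_split/=.
rewrite big_split/=; congr (_ + _).
  by apply: eq_bigr => a _; rewrite -mulr_sumr -mulr_sumr q1 mulr1.
rewrite exchange_big/=; apply: eq_bigr => b _.
under eq_bigr do rewrite (mulrC (p _)) mulrA.
by rewrite -mulr_sumr p1 mulr1.
Qed.

(** Weak duality against the product plan; it keeps [dual_value] finite. *)
Lemma dual_cost_ge (h : V) f g : dual_feasible h f g ->
  \sum_a \sum_b h (a, b) * (p a * q b) <= dual_cost f g.
Proof.
move=> hfg; rewrite -sum_product_weight; apply: ler_sum => a _; apply: ler_sum => b _.
by rewrite ler_wpM2r ?mulr_ge0//.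
Qed.

Lemma dual_value_le h f g : dual_feasible h f g -> dual_value h <= dual_cost f g.
Proof.
move=> hfg; apply: ge_inf; last by exists f, g.
exists (\sum_a \sum_b h (a, b) * (p a * q b)) => _ [f' [g' [hfg' ->]]].
exact: dual_cost_ge.
Qed.

Lemma dual_value_nonempty (h : V) :
  [set r | exists f g, dual_feasible h f g /\ r = dual_cost f g] !=set0.
Proof.
exists (dual_cost (fun=> \sum_z `|h z|) (fun=> 0)).
exists (fun=> \sum_z `|h z|), (fun=> 0); split => // a b; rewrite addr0.
rewrite (bigD1 (a, b))//= (le_trans (ler_norm _))// lerDl.
by apply: sumr_ge0.
Qed.

Lemma le_dual_value h z :
  (forall f g, dual_feasible h f g -> z <= dual_cost f g) -> z <= dual_value h.
Proof.
move=> hz; apply: lb_le_inf; first exact: dual_value_nonempty.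
by move=> _ [f [g [hfg ->]]]; exact: hz.
Qed.

Lemma dual_costD f g f' g' :
  dual_cost (fun a => f a + f' a) (fun b => g b + g' b) = dual_cost f g + dual_cost f' g'.
Proof.
rewrite /dual_cost addrACA -!big_split/=.
by congr (_ + _); apply: eq_bigr => ? _; rewrite mulrDl.
Qed.

Lemma dual_costZ t f g :
  dual_cost (fun a => t * f a) (fun b => t * g b) = t * dual_cost f g.
Proof.
rewrite /dual_cost mulrDr !mulr_sumr.
by congr (_ + _); apply: eq_bigr => ? _; rewrite mulrA.
Qed.

Lemma dual_value0 : dual_value 0 = 0.
Proof.
apply/eqP; rewrite eq_le; apply/andP; split.
  have -> : (0 : R) = dual_cost (fun=> 0) (fun=> 0).
    by rewrite /dual_cost !big1 ?addr0// => ? _; rewrite mul0r.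
  by apply: dual_value_le => a b; rewrite ffunE addr0.
apply: le_dual_value => f g /dual_cost_ge; apply: le_trans.
by rewrite big1// => a _; rewrite big1// => b _; rewrite ffunE mul0r.
Qed.

Lemma sublinear_dual_value : sublinear dual_value.
Proof.
split.
  move=> x y; rewrite -lerBlDr; apply: le_dual_value => f g fg.
  rewrite lerBlDl -lerBlDr; apply: le_dual_value => f' g' fg'.
  rewrite lerBlDr -dual_costD; apply: dual_value_le => a b.
  by rewrite ffunE [leRHS]addrACA addrC lerD.
move=> t x; rewrite le_eqVlt => /predU1P[<-|t0].
  by rewrite scale0r mul0r dual_value0.
apply/eqP; rewrite eq_le; apply/andP; split.
  rewrite mulrC -ler_pdivrMr//; apply: le_dual_value => f g fg.
  rewrite ler_pdivrMr// mulrC -dual_costZ; apply: dual_value_le => a b.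
  by rewrite ffunE -mulrDr ler_pM2l.
apply: le_dual_value => f g fg.
rewrite mulrC -ler_pdivlMr// mulrC -dual_costZ; apply: dual_value_le => a b.
by rewrite -mulrDr mulrC ler_pdivlMr// mulrC; have := fg a b; rewrite ffunE.
Qed.

Definition unit_mass (z : T1 * T2) : V := [ffun z' => (z' == z)%:R].

Lemma ffun_unit_mass (h : V) : h = \sum_(z <- enum {: T1 * T2}) h z *: unit_mass z.
Proof.
apply/ffunP => z; rewrite big_enum/= sum_ffunE (bigD1 z)//= big1; last first.
  by move=> z' zz'; rewrite !ffunE eq_sym (negbTE zz') scaler0.
by rewrite !ffunE eqxx addr0 [_ *: _]mulr1.
Qed.

(** A linear functional L below [dual_value] which agrees with it at - c is
    given by an optimal plan: its values on unit masses are nonnegative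
    because L h <= 0 when h <= 0, and its marginals are p and q because a
    function of one coordinate alone costs its own integral, with either
    sign. *)
Lemma transport_duality (c : T1 -> T2 -> R) e : 0 < e ->
  exists (pi : T1 -> T2 -> R) f g,
  [/\ forall a b, 0 <= pi a b, (forall a, \sum_b pi a b = p a),
      (forall b, \sum_a pi a b = q b), (forall a b, f a + g b <= c a b) &
      \sum_a \sum_b pi a b * c a b <= dual_cost f g + e].
Proof.
move=> e0.
(* The dual pair must dominate - c, which means that its opposite lies below c. *)
pose h0 : V := [ffun z => - c z.1 z.2].
have [L [sL Lp Lh0 Lm]] := hahn_banach_span
  [seq unit_mass z | z <- enum {: T1 * T2}] h0 sublinear_dual_value.
have LE h : L h = \sum_a \sum_b h (a, b) * L (unit_mass (a, b)).
  rewrite pair_big/= [in LHS](ffun_unit_mass h).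
  rewrite [RHS](eq_bigr (fun z => h z * L (unit_mass z))); last by case.
  rewrite -big_enum/=.
  elim: (enum _) => [|z s IH]; first by rewrite !big_nil sublinear0.
  by rewrite !big_cons [X in L X]addrC Lm ?IH 1?addrC// map_f ?mem_enum.
have dc_row a (t : R) : dual_cost (fun a' => t * (a' == a)%:R) (fun=> 0) = t * p a.
  rewrite /dual_cost (bigD1 a)//= eqxx mulr1 !big1 ?addr0// => i; rewrite ?mul0r//.
  by move=> /negbTE ->; rewrite mulr0 mul0r.
have dc_col b (t : R) : dual_cost (fun=> 0) (fun b' => t * (b' == b)%:R) = t * q b.
  rewrite /dual_cost big1 ?add0r => [|i _]; last by rewrite mul0r.
  rewrite (bigD1 b)//= eqxx mulr1 big1 ?addr0// => i.
  by move=> /negbTE ->; rewrite mulr0 mul0r.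
have Lrow a t : t * (\sum_b L (unit_mass (a, b))) <= t * p a.
  have -> : t * (\sum_b L (unit_mass (a, b))) = L [ffun z => t * (z.1 == a)%:R].
    rewrite LE (bigD1 a)//= [X in _ = _ + X]big1 ?addr0; last first.
      by move=> i /negbTE ia; rewrite big1// => j _; rewrite ffunE/= ia mulr0 mul0r.
    by rewrite mulr_sumr; apply: eq_bigr => b _; rewrite ffunE/= eqxx mulr1.
  rewrite (le_trans (Lp _))// -dc_row; apply: dual_value_le => a' b'.
  by rewrite ffunE/= addr0.
have Lcol b t : t * (\sum_a L (unit_mass (a, b))) <= t * q b.
  have -> : t * (\sum_a L (unit_mass (a, b))) = L [ffun z => t * (z.2 == b)%:R].
    rewrite LE exchange_big/= (bigD1 b)//= [X in _ = _ + X]big1 ?addr0; last first.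
      by move=> i /negbTE ia; rewrite big1// => j _; rewrite ffunE/= ia mulr0 mul0r.
    by rewrite mulr_sumr; apply: eq_bigr => a _; rewrite ffunE/= eqxx mulr1.
  rewrite (le_trans (Lp _))// -dc_col; apply: dual_value_le => a' b'.
  by rewrite ffunE/= add0r.
have [] : exists f g, dual_feasible h0 f g /\ dual_cost f g < dual_value h0 + e.
  have hinf : has_inf [set r | exists f g, dual_feasible h0 f g /\ r = dual_cost f g].
    split; first exact: dual_value_nonempty.
    exists (\sum_a \sum_b h0 (a, b) * (p a * q b)) => _ [f' [g' [hfg' ->]]].
    exact: dual_cost_ge.
  by have [_ [f [g [fg ->]]] dfg] := inf_adherent e0 hinf; exists f, g.
move=> f [g [fg dfg]].
exists (fun a b => L (unit_mass (a, b))), (fun a => - f a), (fun b => - g b).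
split.
- move=> a b; have [_ LZ] := sL.
  have : L (- unit_mass (a, b)) <= 0.
    rewrite (le_trans (Lp _))//.
    have <- : dual_cost (fun=> 0) (fun=> 0) = 0.
      by rewrite /dual_cost !big1 ?addr0// => i _; rewrite mul0r.
    by apply: dual_value_le => a' b'; rewrite !ffunE addr0 oppr_le0.
  have := Lm (unit_mass (a, b)); rewrite map_f ?mem_enum// => /(_ isT 0 (-1)).
  by rewrite scaleN1r add0r sublinear0// add0r mulN1r => ->; rewrite oppr_le0.
- move=> a; have := Lrow a 1; have := Lrow a (-1); lra.
- move=> b; have := Lcol b 1; have := Lcol b (-1); lra.
- by move=> a b; have := fg a b; rewrite ffunE/=; lra.
have -> : \sum_a \sum_b L (unit_mass (a, b)) * c a b = - L h0.
  rewrite LE -sumrN; apply: eq_bigr => a _; rewrite -sumrN; apply: eq_bigr => b _.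
  by rewrite ffunE/= mulNr opprK mulrC.
have -> : dual_cost (fun a => - f a) (fun b => - g b) = - dual_cost f g.
  by rewrite /dual_cost opprD -!sumrN; congr (_ + _); apply: eq_bigr => i _; rewrite mulNr.
rewrite Lh0; lra.
Qed.

(** The density of a plan with respect to the product of its marginals.  On
    null cells it is set to 1, so that both marginal identities hold at every
    point and not only at points of positive mass. *)
Lemma transport_density (pi : T1 -> T2 -> R) :
  (forall a b, 0 <= pi a b) -> (forall a, \sum_b pi a b = p a) ->
  (forall b, \sum_a pi a b = q b) ->
  exists w : T1 -> T2 -> R,
  [/\ forall a b, 0 <= w a b, forall a, \sum_b w a b * q b = 1,
      forall b, \sum_a w a b * p a = 1 &
      forall a b, w a b * (p a * q b) = pi a b].
Proof.
move=> pi0 pip piq.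
have pi_p a b : p a = 0 -> pi a b = 0.
  move=> pa0; have := pip a; rewrite pa0 => /eqP.
  by rewrite psumr_eq0// => /allP/(_ b); rewrite mem_index_enum => /(_ isT)/eqP.
have pi_q a b : q b = 0 -> pi a b = 0.
  move=> qb0; have := piq b; rewrite qb0 => /eqP.
  by rewrite psumr_eq0// => /allP/(_ a); rewrite mem_index_enum => /(_ isT)/eqP.
exists (fun a b => if p a * q b == 0 then 1 else pi a b / (p a * q b)); split.
- by move=> a b; case: ifPn => // _; rewrite divr_ge0// mulr_ge0.
- move=> a; have [pa0|pa0] := eqVneq (p a) 0.
    by rewrite -[RHS]q1; apply: eq_bigr => b _; rewrite pa0 mul0r eqxx /= mul1r.
  transitivity ((\sum_b pi a b) / p a); last by rewrite pip divff.
  rewrite mulr_suml; apply: eq_bigr => b _.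
  have [qb0|qb0] := eqVneq (q b) 0; first by rewrite qb0 mulr0 pi_q// mul0r.
  by rewrite (negbTE (mulf_neq0 pa0 qb0)); field; rewrite pa0 qb0.
- move=> b; have [qb0|qb0] := eqVneq (q b) 0.
    by rewrite -[RHS]p1; apply: eq_bigr => a _; rewrite qb0 mulr0 eqxx /= mul1r.
  transitivity ((\sum_a pi a b) / q b); last by rewrite piq divff.
  rewrite mulr_suml; apply: eq_bigr => a _.
  have [pa0|pa0] := eqVneq (p a) 0; first by rewrite pa0 mulr0 pi_p// mul0r.
  by rewrite (negbTE (mulf_neq0 pa0 qb0)); field; rewrite pa0 qb0.
- move=> a b; case: ifPn => [/eqP pq0|pq0]; last by rewrite divfK.
  rewrite pq0 mulr0; move/eqP : pq0; rewrite mulf_eq0 => /orP[] /eqP.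
    by move=> /pi_p ->.
  by move=> /pi_q ->.
Qed.

End transport_duality.

(** * Expectations of bounded measurable functions *)

Section bounded_expectation.
Context d (T : measurableType d) (R : realType).
Implicit Types (f g : T -> R).

Definition bounded_measurable f := measurable_fun [set: T] f /\ exists M, forall x, `|f x| <= M.

Lemma bmeas_cst r : bounded_measurable (cst r).
Proof. by split; [exact: measurable_cst|exists `|r|]. Qed.

Lemma bmeasD f g : bounded_measurable f -> bounded_measurable g ->
  bounded_measurable (fun x => f x + g x).
Proof.
move=> [mf [M fM]] [mg [N gN]]; split; first exact: measurable_funD.
by exists (M + N) => x; rewrite (le_trans (ler_normD _ _))// lerD.
Qed.

Lemma bmeasM f g : bounded_measurable f -> bounded_measurable g ->
  bounded_measurable (fun x => f x * g x).
Proof.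
move=> [mf [M fM]] [mg [N gN]]; split; first exact: measurable_funM.
by exists (M * N) => x; rewrite normrM ler_pM.
Qed.

Lemma bmeasZ r f : bounded_measurable f -> bounded_measurable (fun x => r * f x).
Proof. by move=> bf; apply: bmeasM => //; exact: bmeas_cst. Qed.

Lemma bmeasB f g : bounded_measurable f -> bounded_measurable g ->
  bounded_measurable (fun x => f x - g x).
Proof.
move=> bf bg; under eq_fun do rewrite -mulN1r.
by apply: bmeasD => //; exact: bmeasZ.
Qed.

Lemma bmeas_sum (I : Type) (s : seq I) (F : I -> T -> R) :
  (forall i, bounded_measurable (F i)) -> bounded_measurable (fun x => \sum_(i <- s) F i x).
Proof.
move=> bF; elim: s => [|i s IH].
  by under eq_fun do rewrite big_nil; exact: bmeas_cst.
by under eq_fun do rewrite big_cons; exact: bmeasD.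
Qed.

Lemma bmeas_norm f : bounded_measurable f -> bounded_measurable (fun x => `|f x|).
Proof.
move=> [mf [M fM]]; split; first exact: measurableT_comp.
by exists M => x; rewrite normr_id.
Qed.

Lemma bmeas_max f g : bounded_measurable f -> bounded_measurable g ->
  bounded_measurable (fun x => Num.max (f x) (g x)).
Proof.
move=> [mf [M fM]] [mg [N gN]]; split; first exact: measurable_maxr.
exists (M + N) => x; have := fM x; have := gN x.
have := normr_ge0 (f x); have := normr_ge0 (g x).
by case: (leP (f x) (g x)) => _; lra.
Qed.

Lemma bmeas_indic (A : set T) : measurable A -> bounded_measurable \1_A.
Proof.
move=> mA; split; first exact: measurable_indic.
by exists 1 => x; rewrite indicE; case: (_ \in _); rewrite /= ?normr1 ?normr0.
Qed.

Definition measurable_label (L : finType) (u : T -> L) := forall a, measurable (u @^-1` [set a]).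

Lemma label_indic (L : finType) (u : T -> L) (g : L -> R) x :
  g (u x) = \sum_a g a * \1_(u @^-1` [set a]) x.
Proof.
rewrite (bigD1 (u x))//= indicE mem_set// mulr1 big1 ?addr0// => a aux.
by rewrite indicE memNset ?mulr0// => /= /esym/eqP; rewrite (negbTE aux).
Qed.

Lemma bmeas_label (L : finType) (u : T -> L) (g : L -> R) : measurable_label u ->
  bounded_measurable (fun x => g (u x)).
Proof.
move=> ulab; under eq_fun do rewrite label_indic.
by apply: bmeas_sum => a; apply: bmeasZ; exact: bmeas_indic.
Qed.

Context (P : probability T R).

Lemma bmeas_integrable f : bounded_measurable f -> P.-integrable [set: T] (EFin \o f).
Proof.
move=> [mf [M fM]]; apply: measurable_bounded_integrable => //.
  by rewrite (le_lt_trans (probability_le1 P measurableT))// ltry.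
exists M; split; first exact: num_real.
by move=> N MN x _ /=; rewrite (le_trans (fM x))// ltW.
Qed.

Lemma EFin_expect f : bounded_measurable f -> (\int[P]_x (f x)%:E)%E = (\int[P]_x f x)%:E.
Proof.
move=> bf; rewrite /Rintegral fineK//.
by apply: integrable_fin_num => //; exact: bmeas_integrable.
Qed.

Lemma expectD f g : bounded_measurable f -> bounded_measurable g ->
  \int[P]_x (f x + g x) = \int[P]_x f x + \int[P]_x g x.
Proof. by move=> bf bg; rewrite RintegralD//; exact: bmeas_integrable. Qed.

Lemma expectB f g : bounded_measurable f -> bounded_measurable g ->
  \int[P]_x (f x - g x) = \int[P]_x f x - \int[P]_x g x.
Proof. by move=> bf bg; rewrite RintegralB//; exact: bmeas_integrable. Qed.

Lemma expectZ r f : bounded_measurable f -> \int[P]_x (r * f x) = r * \int[P]_x f x.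
Proof. by move=> bf; rewrite RintegralZl//; exact: bmeas_integrable. Qed.

Lemma expect_cst r : \int[P]_x r = r.
Proof. by rewrite Rintegral_cst// [X in fine X](@probability_setT _ _ _ P) mulr1. Qed.

Lemma expect_sum (I : Type) (s : seq I) (F : I -> T -> R) :
  (forall i, bounded_measurable (F i)) ->
  \int[P]_x (\sum_(i <- s) F i x) = \sum_(i <- s) \int[P]_x F i x.
Proof.
move=> bF; elim: s => [|i s IH].
  by under eq_Rintegral do rewrite big_nil; rewrite big_nil expect_cst.
under eq_Rintegral do rewrite big_cons.
by rewrite expectD// ?IH ?big_cons//; exact: bmeas_sum.
Qed.

Lemma expect_indic (A : set T) : measurable A -> \int[P]_x \1_A x = fine (P A).
Proof. by move=> mA; rewrite /Rintegral integral_indic// setIT. Qed.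

Lemma expect_label (L : finType) (u : T -> L) (g : L -> R) : measurable_label u ->
  \int[P]_x g (u x) = \sum_a g a * fine (P (u @^-1` [set a])).
Proof.
move=> ulab; under eq_Rintegral do rewrite label_indic.
rewrite expect_sum; last by move=> a; apply: bmeasZ; exact: bmeas_indic.
by apply: eq_bigr => a _; rewrite expectZ ?expect_indic//; exact: bmeas_indic.
Qed.

Lemma label_prob_sum1 (L : finType) (u : T -> L) : measurable_label u ->
  \sum_a fine (P (u @^-1` [set a])) = 1.
Proof.
move=> ulab; rewrite -[RHS](expect_cst 1) (expect_label (fun=> 1) ulab).
by apply: eq_bigr => a _; rewrite mul1r.
Qed.

Lemma le_expect f g : bounded_measurable f -> bounded_measurable g -> (forall x, f x <= g x) ->
  \int[P]_x f x <= \int[P]_x g x.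
Proof. by move=> bf bg fg; apply: le_Rintegral => //; exact: bmeas_integrable. Qed.

Lemma ae_eq_expect f g : bounded_measurable f -> bounded_measurable g ->
  {ae P, forall x, f x = g x} ->
  \int[P]_x f x = \int[P]_x g x.
Proof.
move=> [mf _] [mg _] fg; rewrite /Rintegral; congr fine.
apply: ae_eq_integral => //; [exact/measurable_EFinP|exact/measurable_EFinP|].
by apply: filterS fg => x -> _.
Qed.

Lemma ae_le_expect f g : bounded_measurable f -> bounded_measurable g ->
  {ae P, forall x, f x <= g x} ->
  \int[P]_x f x <= \int[P]_x g x.
Proof.
move=> bf bg fg; have bm := bmeas_max bf bg.
rewrite -(@ae_eq_expect _ g bm bg); last by apply: filterS fg => x /max_idPr.
by apply: le_expect => // x; rewrite le_max lexx.
Qed.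

End bounded_expectation.

Lemma bmeas_comp (R : realType) d1 d2 (T1 : measurableType d1) (T2 : measurableType d2)
    (f : T2 -> R) (h : T1 -> T2) :
  bounded_measurable f -> measurable_fun setT h -> bounded_measurable (fun x => f (h x)).
Proof.
move=> [mf [N fN]] mh; split; last by exists N => x; exact: fN.
exact: (measurableT_comp mf mh).
Qed.

Section lower_integral.
Context d (T : measurableType d) (R : realType).
Import HBNNSimple.
Local Open Scope ereal_scope.

(** The integral of a nonnegative function is the supremum of the integrals
    of the simple functions below it; pulled back along [Phi], each of these
    is almost surely below g.  This is how costs such as [W], known only
    through pointwise bounds, are integrated. *)
Lemma integral_distribution_le d' (T' : measurableType d') (P : probability T R)
    (Phi : {mfun T >-> T'}) (h : T' -> \bar R) (g : T -> R) :
  (forall y, 0 <= h y) -> bounded_measurable g ->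
  {ae P, forall x, h (Phi x) <= (g x)%:E} ->
  \int[distribution P Phi]_y h y <= (\int[P]_x g x)%R%:E.
Proof.
move=> h0 bg hg; rewrite ge0_integralTE//; apply: ge_ereal_sup => _ [s /= sh <-].
rewrite -integralT_nnsfun ge0_integral_distribution; last 2 first.
- exact/measurable_EFinP.
- by move=> y; rewrite lee_fin.
have bg0 : bounded_measurable (fun x => Num.max (g x) 0%R) by exact: bmeas_max bg (bmeas_cst _ _).
rewrite -(@ae_eq_expect _ _ _ P (fun x => Num.max (g x) 0%R) g)//; last first.
  by apply: filterS hg => x hx; apply/max_idPl; rewrite -lee_fin (le_trans (h0 _) hx).
rewrite -EFin_expect//; apply: ae_ge0_le_integral => //.
- by move=> x _ /=; rewrite lee_fin.
- by apply/measurable_EFinP; apply: measurableT_comp.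
- by move=> x _; rewrite lee_fin le_max lexx orbT.
- by apply/measurable_EFinP; case: bg0.
- apply: filterS hg => x hx _ /=.
  by rewrite (le_trans (sh _))// (le_trans hx)// lee_fin le_max lexx.
Qed.

Lemma ge0_le_integral_lower (m : {measure set T -> \bar R}) (f g : T -> \bar R) :
  (forall x, 0 <= f x) -> (forall x, f x <= g x) ->
  \int[m]_x f x <= \int[m]_x g x.
Proof.
move=> f0 fg; have g0 x : 0 <= g x by rewrite (le_trans (f0 x)).
rewrite !ge0_integralTE//; apply: le_ereal_sup => _ [s /= sf <-].
by exists s => // x; rewrite (le_trans (sf x)).
Qed.

End lower_integral.

(** * Reweighting a product measure by a density on labels *)

Section finite_sums_of_measures.
Context d (T : measurableType d) (R : realType) (L : finType).
Local Open Scope ereal_scope.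

Context (m : L -> {measure set T -> \bar R}).

(** [msum] ranges over an initial segment of nat, hence the enumeration. *)
Definition fsum_measure : set T -> \bar R :=
  msum (fun k => if insub k is Some i then m (@enum_val _ {: L} i) else mzero) #|{: L}|.

HB.instance Definition _ := Measure.on fsum_measure.

Lemma fsum_measureE A : fsum_measure A = \sum_a m a A.
Proof.
rewrite /fsum_measure /= /msum [RHS]big_enum_val/=; apply: eq_bigr => i _.
by rewrite valK.
Qed.

Lemma integral_fsum_measure (f : T -> \bar R) :
  measurable_fun setT f -> (forall x, 0 <= f x) ->
  \int[fsum_measure]_x f x = \sum_a \int[m a]_x f x.
Proof.
move=> mf f0; rewrite ge0_integral_measure_sum// [RHS]big_enum_val/=.
by apply: eq_bigr => i _; rewrite valK.
Qed.

End finite_sums_of_measures.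

Section density_coupling.
Context (R : realType) d1 d2 (O1 : measurableType d1) (O2 : measurableType d2).
Context (mu1 : probability O1 R) (mu2 : probability O2 R).
Context (L1 L2 : finType) (u : O1 -> L1) (v : O2 -> L2).
Hypotheses (ulab : measurable_label u) (vlab : measurable_label v).

Definition label_prob d (T : measurableType d) (P : probability T R) (L : finType)
  (u : T -> L) (a : L) : R := fine (P (u @^-1` [set a])).

Lemma label_prob_ge0 d (T : measurableType d) (P : probability T R) (L : finType)
  (t : T -> L) a : 0 <= label_prob P t a.
Proof. exact: fine_ge0. Qed.

Lemma label_split d (T : measurableType d) (P : probability T R) (L : finType)
    (t : T -> L) (A : set T) : measurable_label t -> measurable A ->
  \sum_a fine (P (A `&` t @^-1` [set a])) = fine (P A).
Proof.
move=> mt mA; rewrite -expect_indic//.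
have mAt a : measurable (A `&` t @^-1` [set a]) by exact: measurableI.
transitivity (\int[P]_x (\sum_a \1_(A `&` t @^-1` [set a]) x)).
  rewrite expect_sum; last by move=> a; exact: bmeas_indic.
  by apply: eq_bigr => a _; rewrite expect_indic.
apply: eq_Rintegral => x _; rewrite (bigD1 (t x))//= big1 ?addr0; last first.
  move=> a atx; rewrite indicE memNset// => -[_ /= /esym/eqP].
  by rewrite (negbTE atx).
by rewrite indicI/= [X in _ * X]indicE mem_set// mulr1.
Qed.

Lemma mlabel_pair : measurable_label (fun z : O1 * O2 => (u z.1, v z.2)).
Proof.
move=> [a b]; rewrite (_ : _ @^-1` _ = (u @^-1` [set a]) `*` (v @^-1` [set b])).
  exact: measurableX.
by apply/seteqP; split => -[x y]/=; [case=> -> ->|move=> [-> ->]].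
Qed.

(** The product measure is reweighted by w on each product of cells.  The
    hypotheses on w say that its partial averages are 1, which is what keeps
    the marginals equal to [mu1] and [mu2]. *)
Lemma density_coupling (w : L1 -> L2 -> R) :
  (forall a b, 0 <= w a b) ->
  (forall a, \sum_b w a b * label_prob mu2 v b = 1) ->
  (forall b, \sum_a w a b * label_prob mu1 u a = 1) ->
  exists g : probability (O1 * O2)%type R,
  [/\ forall A, measurable A -> g (fst @^-1` A) = mu1 A,
      forall B, measurable B -> g (snd @^-1` B) = mu2 B &
      forall F : L1 -> L2 -> R, \int[g]_z F (u z.1) (v z.2) =
       \sum_a \sum_b w a b * (label_prob mu1 u a * label_prob mu2 v b) * F a b].
Proof.
move=> w0 w2 w1.
pose cell (z : L1 * L2) := (u @^-1` [set z.1]) `*` (v @^-1` [set z.2]).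
have mcell z : measurable (cell z) by exact: measurableX.
pose piece (z : L1 * L2) : {measure set (O1 * O2)%type -> \bar R} :=
  mscale (NngNum (w0 z.1 z.2)) (mrestr (mu1 \x mu2)%E (mcell z)).
pose m := fsum_measure piece.
have mE A : m A = (\sum_z (w z.1 z.2)%:E * (mu1 \x mu2) (A `&` cell z))%E.
  exact: fsum_measureE.
have fin_m A : measurable A -> m A = (\sum_a \sum_b w a b *
    fine ((mu1 \x mu2)%E (A `&` cell (a, b))))%:E.
  move=> mA; rewrite mE pair_big/= -sumEFin; apply: eq_bigr => -[a b] _ /=.
  rewrite EFinM fineK// ge0_fin_numE//.
  rewrite (le_lt_trans (probability_le1 (mu1 \x mu2)%E _)) ?ltry//.
  exact: measurableI.
have prodE (A : set O1) (B : set O2) : measurable A -> measurable B ->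
    fine ((mu1 \x mu2)%E (A `*` B)) = fine (mu1 A) * fine (mu2 B).
  move=> mA mB; rewrite product_measure1E// fineM//.
    by rewrite fin_num_measure.
  by rewrite fin_num_measure.
have m_rect (A : set O1) (B : set O2) : measurable A -> measurable B -> m (A `*` B) =
    (\sum_a \sum_b w a b * (fine (mu1 (A `&` u @^-1` [set a])) *
                            fine (mu2 (B `&` v @^-1` [set b]))))%:E.
  move=> mA mB; rewrite fin_m; last exact: measurableX.
  congr EFin; apply: eq_bigr => a _; apply: eq_bigr => b _.
  by rewrite -setXI prodE//; exact: measurableI.
have m1 A : measurable A -> m (A `*` setT) = mu1 A.
  move=> mA; rewrite m_rect//.
  rewrite -[RHS]fineK ?fin_num_measure//; congr EFin.
  rewrite -(label_split mu1 ulab mA); apply: eq_bigr => a _.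
  rewrite -[RHS]mulr1 -(w2 a) mulr_sumr; apply: eq_bigr => b _.
  by rewrite setTI mulrCA.
have m2 B : measurable B -> m (setT `*` B) = mu2 B.
  move=> mB; rewrite m_rect//.
  rewrite -[RHS]fineK ?fin_num_measure//; congr EFin.
  rewrite -(label_split mu2 vlab mB) exchange_big; apply: eq_bigr => b _.
  rewrite -[RHS]mul1r -(w1 b) mulr_suml; apply: eq_bigr => a _.
  by rewrite setTI mulrA.
have mT : m setT = 1%E by rewrite -setXTT m1// probability_setT.
pose g : probability (O1 * O2)%type R := HB.pack m (Measure_isProbability.Build _ _ _ m mT).
exists g; split.
- by move=> A mA; rewrite -m1//; congr m; apply/seteqP; split => -[x y]/=; [|case].
- by move=> A mA; rewrite -m2//; congr m; apply/seteqP; split => -[x y]/=; [|case].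
- move=> F; have := expect_label g (fun z => F z.1 z.2) mlabel_pair => /= ->.
  rewrite [RHS]pair_big/=; apply: eq_bigr => -[a b] _ /=.
  rewrite (_ : _ @^-1` _ = (u @^-1` [set a]) `*` (v @^-1` [set b])); last first.
    by apply/seteqP; split => -[x y]/=; [case=> -> ->|move=> [-> ->]].
  transitivity (F a b * fine (m (cell (a, b)))); first by [].
  rewrite /cell m_rect//= mulrC; congr (_ * _).
  rewrite (bigD1 a)//= (bigD1 b)//= !setIid big1 ?addr0; last first.
    move=> b' b'b; rewrite [X in mu2 X](_ : _ = set0) ?measure0 ?mulr0//.
    apply/seteqP; split => // y [/= -> /esym/eqP]; by rewrite (negbTE b'b).
  rewrite big1 ?addr0// => a' a'a; rewrite big1// => b' _.
  rewrite [X in mu1 X](_ : _ = set0) ?measure0 ?mul0r ?mulr0//.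
  apply/seteqP; split => // y [/= -> /esym/eqP]; by rewrite (negbTE a'a).
Qed.

End density_coupling.

(** * Finite labellings and approximate duality on cells *)

Section first_hit.
Context d (T : measurableType d).
Variables (B : nat -> set T) (mB : forall n, measurable (B n)) (N : nat).

(** The value N is reserved for the points that lie in none of the first N
    sets. *)
Definition first_hit (x : T) : 'I_N.+1 := inord (find (fun n => `[< B n x >]) (iota 0 N)).

Lemma first_hitE x : first_hit x = find (fun n => `[< B n x >]) (iota 0 N) :> nat.
Proof. by rewrite inordK// ltnS (leq_trans (find_size _ _))// size_iota. Qed.

Lemma first_hit_hit x : (first_hit x < N)%N -> B (first_hit x) x.
Proof.
rewrite first_hitE => h.
have := @nth_find _ 0 (fun n => `[< B n x >]) (iota 0 N).
by rewrite has_find size_iota => /(_ h); rewrite nth_iota// add0n => /asboolP.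
Qed.

Lemma first_hit_miss x n : (n < first_hit x)%N -> ~ B n x.
Proof.
rewrite first_hitE => h Bnx.
have := @before_find _ 0 (fun n => `[< B n x >]) (iota 0 N) n h.
rewrite nth_iota; last by rewrite (leq_trans h)// (leq_trans (find_size _ _))// size_iota.
by rewrite add0n => /asboolP.
Qed.

Lemma first_hit_lt x n : (n < N)%N -> B n x -> (first_hit x < N)%N.
Proof.
move=> nN Bnx; rewrite ltnNge; apply/negP => h.
exact: (first_hit_miss (leq_trans nN h)).
Qed.

Lemma mlabel_first_hit : measurable_label first_hit.
Proof.
move=> a; rewrite (_ : _ @^-1` _ = (\bigcap_(n in `I_a) ~` B n) `&`
    (if (a < N)%N then B a else setT)); last first.
  apply/seteqP; split => x /=.
    move=> <-; split; first by move=> n /= /first_hit_miss.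
    by case: ifPn => // /first_hit_hit.
  move=> [miss hit]; apply/val_inj => /=; apply/eqP; rewrite eqn_leq; apply/andP; split.
    rewrite leqNgt; apply/negP => ax.
    have aN : (a < N)%N by rewrite (leq_trans ax)// -ltnS.
    by move: hit; rewrite aN; exact: first_hit_miss.
  rewrite leqNgt; apply/negP => xa; apply: (miss _ xa).
  by apply: first_hit_hit; rewrite (leq_trans xa)// -ltnS.
apply: measurableI; last by case: ifP.
by apply: bigcap_measurableType => n _; exact: measurableC.
Qed.

End first_hit.

Section covers.
Context d (T : measurableType d) (R : realType).

Lemma first_hit_rest_small (B : nat -> set T) (P : probability T R) (e : R) :
  (forall n, measurable (B n)) -> (forall x, exists n, B n x) -> 0 < e ->
  \forall N \near \oo, label_prob P (first_hit B N) ord_max <= e.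
Proof.
move=> mB cB e0; pose F N := first_hit B N @^-1` [set ord_max].
have mF N : measurable (F N) by exact: mlabel_first_hit.
have FE N x : F N x <-> forall n, (n < N)%N -> ~ B n x.
  split => [/= h n nN|h /=]; first by apply: (@first_hit_miss _ _ B N); rewrite h.
  apply/val_inj/eqP; rewrite /= eqn_leq -ltnS ltn_ord/= leqNgt; apply/negP => hN.
  exact: (h _ hN (first_hit_hit hN)).
have : P (F n) @[n --> \oo] --> P (\bigcap_n F n).
  apply: nonincreasing_cvg_mu => //.
  - by rewrite (le_lt_trans (probability_le1 P (mF 0)))// ltry.
  - exact: bigcap_measurableType.
  - move=> n m nm; apply/subsetPset => x /FE h; apply/FE => k kn.
    exact: h (leq_trans kn nm).
have -> : \bigcap_n F n = set0.
  apply/seteqP; split => // x h; have [n Bn] := cB x.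
  by have /FE/(_ n (ltnSn _)) := h n.+1 I.
rewrite measure0 => /fine_cvgP[_ /cvgrPdist_le/(_ _ e0)].
apply: filterS => N; rewrite /= sub0r normrN.
exact: le_trans (ler_norm _).
Qed.

End covers.

Lemma grid_label (R : realType) (e : R) : 0 < e ->
  exists (L : finType) (k : R -> L) (t : L -> R),
  measurable_label k /\ forall x, 0 <= x <= 1 -> t (k x) <= x <= t (k x) + e.
Proof.
move=> e0; pose B n : set R := `[n%:R * e, n%:R * e + e]%classic.
pose N := (Num.truncn (e^-1)).+1.
exists 'I_N.+1, (first_hit B N), (fun a : 'I_N.+1 => (a : nat)%:R * e); split.
  by apply: mlabel_first_hit => n; exact: measurable_itv.
move=> x /andP[x0 x1].
have h : (first_hit B N x < N)%N.
  have xe0 : 0 <= x / e by rewrite divr_ge0// ltW.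
  apply: (@first_hit_lt _ _ B N x (Num.truncn (x / e))).
    by rewrite ltnS; apply: le_truncn; rewrite ler_pdivrMr// mulVf// gt_eqF.
  have /andP[h1 h2] := truncn_itv xe0.
  rewrite /B/= in_itv/=; apply/andP; split; first by rewrite -ler_pdivlMr.
  rewrite (_ : _ + e = (Num.truncn (x / e)).+1%:R * e); last first.
    by rewrite -natr1 mulrDl mul1r.
  by rewrite -ler_pdivrMr// ltW.
by have := first_hit_hit h; rewrite /B/= in_itv.
Qed.

Section cell_transport.
Context (R : realType) (X : completeMetricType R).

Lemma lip1_bmeas (f : X -> R) (M : R) : (forall x y : X, mdist x y <= M) -> lip1 f ->
  bounded_measurable (f : borel X -> R).
Proof.
move=> XM f1; have [cf bf] := lip1_bounded_continuous (ex_intro _ M XM) f1.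
split; last first.
  have [N [_ fN]] := bf; exists (N + 1) => x; apply: fN => //.
  by rewrite ltrDl.
apply: (measurability _ (RGenOpens.measurableE R)).
move=> _ [_ [a [b ->]] <-]; rewrite setTI; apply: sub_sigma_algebra => /=.
by apply: open_comp; [move=> x _; exact: cf|exact: interval_open].
Qed.

Lemma lip1_shift (f : X -> R) s : lip1 f -> lip1 (fun x => f x - s).
Proof. by move=> f1 x y; rewrite opprD addrACA subrr addr0; exact: f1. Qed.

(** A 1-Lipschitz function oscillates by at most the diameter, and the
    distances only see it up to an additive constant. *)
Lemma lip1_normalize (f : X -> R) (M : R) : (forall x y : X, mdist x y <= M) -> lip1 f ->
  exists s, forall x, 0 <= f x - s <= M.
Proof.
move=> XM f1; have fxy x y : f x - M <= f y.
  rewrite lerBlDr -lerBlDl (le_trans (ler_norm _))// (le_trans (f1 _ _))//.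
have lbf x : lbound (range f) (f x - M) by move=> _ [y _ <-]; exact: fxy.
exists (inf (range f)) => x; apply/andP; split.
  by rewrite subr_ge0 ge_inf//; exists (f x - M).
rewrite lerBlDl -lerBlDr; apply: lb_le_inf => //; by exists (f x), x.
Qed.

Lemma measurable_mball (x : X) e : measurable (ball x e : set (borel X)).
Proof.
apply: sub_sigma_algebra => /=; rewrite openE => y.
rewrite ballEmdist/= => xye; apply/nbhs_ballP; exists (e - mdist x y) => /=.
  by rewrite subr_gt0.
move=> z; rewrite !ballEmdist/= ltrBrDl; exact: le_lt_trans (metric_triangle _ _ _).
Qed.

Lemma separable_net e : separable X -> 0 < e ->
  exists s : nat -> X, forall x, exists n, ball (s n) e x.
Proof.
move=> [D cD dD] e0; have /countable_injP[g ginj] := cD.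
exists (fun n => xget point [set y | D y /\ g y = n]) => x.
have [|y [xy Dy]] := dD (ball x e)° _ (open_interior _).
  by exists x; apply: nbhsx_ballx.
exists (g y); case: xgetP => [z _ [Dz gz]|/(_ y)]; last by case.
rewrite (ginj z y) ?inE//.
by apply: ball_sym; exact: interior_subset xy.
Qed.

(** Balls of radius e' centred at a dense sequence give finitely many cells,
    and a rest of mass at most e' for both measures.  Replacing a point by the
    centre of its cell costs e' on the balls and at most M on the rest; the
    transport problem between the centres is solved by [transport_duality].
    Of the dual pair (phi, psi), only psi is kept: the infimal convolution
    f0 x = min_b (d(x, y_b) - psi_b) is 1-Lipschitz on the whole of X, lies
    above phi and below - psi at the centres, hence performs at least as
    well. *)
Lemma cell_transport (M : R) (P1 P2 : probability (borel X) R) (e : R) :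
  (forall x y : X, mdist x y <= M) -> separable X -> 0 < e ->
  exists (L : finType) (c : borel X -> L) (D w : L -> L -> R) (f : X -> R),
  [/\ measurable_label c /\ (forall x y : X, mdist x y <= D (c x) (c y)),
      forall a b, 0 <= w a b,
      (forall a, \sum_b w a b * label_prob P2 c b = 1) /\
      (forall b, \sum_a w a b * label_prob P1 c a = 1),
      lip1 f /\ (forall x, 0 <= f x <= M) &
      \sum_a \sum_b w a b * (label_prob P1 c a * label_prob P2 c b) * D a b
      <= \int[P1]_x f x - \int[P2]_x f x + e].
Proof.
move=> XM sX e0.
have M0 : 0 <= M by exact: le_trans (mdist_ge0 _ _) (XM point point).
(* Each of the four replacements of a point by a centre costs at most (1 + M) e'
   on average, and the choice of a nearly optimal dual pair costs e'. *)
pose e' := e / (5 + 4 * M).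
have e'0 : 0 < e' by rewrite divr_gt0//; lra.
have eE : e = (5 + 4 * M) * e' by rewrite mulrC divfK// gt_eqF//; lra.
have [s cov] := separable_net sX e'0.
pose B n : set (borel X) := ball (s n) e'.
have mB n : measurable (B n) by exact: measurable_mball.
have small P := first_hit_rest_small P mB cov e'0.
have [N _ restN] := filterI (small P1) (small P2).
have [rest1 rest2] := restN N (leqnn _).
pose c := first_hit B N; have mc : measurable_label c by exact: mlabel_first_hit.
pose y (a : 'I_N.+1) := s a.
pose dl (a : 'I_N.+1) := if (a < N)%N then e' else M.
have near_y (x : X) : mdist x (y (c x)) <= dl (c x).
  rewrite /dl; case: ifPn => // cN; have := @first_hit_hit _ _ B N x cN.
  by rewrite /B ballEmdist/= metric_sym => /ltW.
have dlE (P : probability (borel X) R) : label_prob P c ord_max <= e' ->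
    \sum_a dl a * label_prob P c a <= (1 + M) * e'.
  move=> rest; rewrite mulrDl mul1r.
  apply: (@le_trans _ _ (\sum_a (e' * label_prob P c a +
      (if a == ord_max then M * label_prob P c ord_max else 0)))).
    apply: ler_sum => a _; have pa0 : 0 <= label_prob P c a by exact: label_prob_ge0.
    rewrite /dl; case: ifPn => [aN|aN].
      by rewrite lerDl; case: ifP => // _; exact: mulr_ge0 M0 (label_prob_ge0 _ _ _).
    have -> : a = ord_max.
      by apply/val_inj/eqP; rewrite /= eqn_leq -ltnS ltn_ord leqNgt.
    by rewrite eqxx lerDr; exact: mulr_ge0 (ltW e'0) (label_prob_ge0 _ _ _).
  rewrite big_split/= -mulr_sumr label_prob_sum1// mulr1 lerD2l -big_mkcond big_pred1_eq.
  exact: ler_wpM2l.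
pose p := label_prob P1 c; pose q := label_prob P2 c.
have p0 a : 0 <= p a by exact: label_prob_ge0.
have q0 a : 0 <= q a by exact: label_prob_ge0.
have p1 : \sum_a p a = 1 by exact: label_prob_sum1.
have q1 : \sum_a q a = 1 by exact: label_prob_sum1.
have [pi [phi [psi [pi0 pip piq phipsi opt]]]] :=
  transport_duality p0 q0 p1 q1 (fun a b => mdist (y a) (y b)) e'0.
have [w [w0 w2 w1 wE]] := transport_density p0 q0 p1 q1 pi0 pip piq.
pose f0 (x : X) := \big[Num.min/mdist x (y ord0) - psi ord0]_(b < N.+1) (mdist x (y b) - psi b).
have f0_le x b : f0 x <= mdist x (y b) - psi b by exact: bigmin_le.
have le_f0 x z : (forall b, z <= mdist x (y b) - psi b) -> z <= f0 x.
  by move=> h; apply/bigmin_geP; split => // i _.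
have lipf0 : lip1 f0.
  have h x z : f0 x - f0 z <= mdist x z.
    rewrite lerBlDr -lerBlDl; apply: le_f0 => b; have := f0_le x b.
    have := metric_triangle x z (y b); lra.
  by move=> x z; rewrite ler_norml h andbT lerNl opprB metric_sym.
have [r f0r] := lip1_normalize XM lipf0.
have bf0 := lip1_bmeas XM lipf0.
exists 'I_N.+1, c, (fun a b => dl a + mdist (y a) (y b) + dl b), w, (fun x => f0 x - r).
split => //.
- split => // x z.
  rewrite (le_trans (metric_triangle x (y (c x)) z))// -addrA lerD//.
  rewrite (le_trans (metric_triangle _ (y (c z)) z))// lerD//.
  by rewrite metric_sym.
- by split=> //; exact: lip1_shift.
rewrite !expectB//; [|exact: bmeas_cst|exact: bmeas_cst].
rewrite !expect_cst.
have bstep : bounded_measurable (fun x : borel X => f0 (y (c x))).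
  exact: (bmeas_label (fun a => f0 (y a)) mc).
have bdl : bounded_measurable (fun x : borel X => dl (c x)) by exact: (bmeas_label dl mc).
have f0c x : `|f0 x - f0 (y (c x))| <= dl (c x).
  exact: le_trans (lipf0 _ _) (near_y x).
have f1E : \sum_a f0 (y a) * p a <= \int[P1]_x f0 x + \sum_a dl a * p a.
  rewrite -(expect_label P1 (fun a => f0 (y a)) mc) -(expect_label P1 dl mc).
  rewrite -expectD//; apply: le_expect => // [|x]; first exact: bmeasD.
  by have := f0c x; rewrite ler_norml => /andP[]; lra.
have f2E : \int[P2]_x f0 x <= \sum_a f0 (y a) * q a + \sum_a dl a * q a.
  rewrite -(expect_label P2 (fun a => f0 (y a)) mc) -(expect_label P2 dl mc).
  rewrite -expectD//; apply: le_expect => // [|x]; first exact: bmeasD.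
  by have := f0c x; rewrite ler_norml => /andP[]; lra.
have dual : dual_cost p q phi psi <= \sum_a f0 (y a) * p a - \sum_a f0 (y a) * q a.
  rewrite /dual_cost -sumrN; apply: lerD; apply: ler_sum => a _.
    rewrite ler_wpM2r//; apply: le_f0 => b; have := phipsi a b; lra.
  rewrite -mulNr ler_wpM2r// lerNr (le_trans (f0_le _ a))// mdistxx sub0r; lra.
have cost : \sum_a \sum_b w a b * (p a * q b) * (dl a + mdist (y a) (y b) + dl b) =
    \sum_a dl a * p a + \sum_a \sum_b pi a b * mdist (y a) (y b) + \sum_a dl a * q a.
  under eq_bigr do under eq_bigr do rewrite wE !mulrDr.
  under eq_bigr do rewrite !big_split/=.
  rewrite !big_split/=; congr (_ + _ + _).
    by apply: eq_bigr => a _; rewrite -mulr_suml pip mulrC.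
  by rewrite exchange_big/=; apply: eq_bigr => a _; rewrite -mulr_suml piq mulrC.
have := dlE P1 rest1; have := dlE P2 rest2; rewrite -/p -/q cost.
have := eE; lra.
Qed.

End cell_transport.

(** * Kantorovich duality and elementary bounds on the distances *)

Section wasserstein_bounds.
Context (R : realType) (X : completeMetricType R).
Variables (M : R) (XM : forall x y : X, mdist x y <= M).
Local Open Scope ereal_scope.

Lemma expect_distribution d d' (T : measurableType d) (T' : measurableType d')
    (P : probability T R) (Y : {mfun T >-> T'}) (f : T' -> R) : bounded_measurable f ->
  (\int[distribution P Y]_y f y = \int[P]_x f (Y x))%R.
Proof.
move=> bf; have bfY : bounded_measurable (f \o Y) by exact: bmeas_comp.
rewrite /Rintegral integral_distribution//; first exact/measurable_EFinP/(proj1 bf).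
exact: bmeas_integrable.
Qed.

Lemma expect_coupling d (T : measurableType d) (mu nu : probability T R)
    (g : probability (T * T)%type R) (f : T -> R) :
  coupling mu nu g -> bounded_measurable f ->
  (\int[g]_z f z.1 = \int[mu]_x f x /\ \int[g]_z f z.2 = \int[nu]_x f x)%R.
Proof.
move=> gc bf.
pose F1 : {mfun (T * T)%type >-> T} :=
  HB.pack fst (isMeasurableFun.Build _ _ _ _ _ (@measurable_fst _ _ T T)).
pose F2 : {mfun (T * T)%type >-> T} :=
  HB.pack snd (isMeasurableFun.Build _ _ _ _ _ (@measurable_snd _ _ T T)).
split.
  rewrite -(@expect_distribution _ _ _ _ g F1 f)//; congr fine.
  by apply: eq_measure_integral => A mA _; have [] := gc A mA.
rewrite -(@expect_distribution _ _ _ _ g F2 f)//; congr fine.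
by apply: eq_measure_integral => A mA _; have [] := gc A mA.
Qed.

Lemma W_ge0 (P Q : probability (borel X) R) : 0 <= W P Q.
Proof.
apply: le_ereal_inf_tmp => _ [g _ <-]; apply: integral_ge0 => z _.
by rewrite lee_fin mdist_ge0.
Qed.

Lemma mean_gap_le_W (P Q : probability (borel X) R) (f : X -> R) : lip1 f ->
  `|\int[P]_x f x - \int[Q]_x f x|%R%:E <= W P Q.
Proof.
move=> f1; have bf := lip1_bmeas XM f1.
apply: le_ereal_inf_tmp => _ [g gc <-].
have [E1 E2] := expect_coupling gc bf.
have bf1 : bounded_measurable (fun z : borel X * borel X => f z.1) := bmeas_comp bf measurable_fst.
have bf2 : bounded_measurable (fun z : borel X * borel X => f z.2) := bmeas_comp bf measurable_snd.
rewrite -E1 -E2 -expectB//.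
apply: (@le_trans _ _ (\int[g]_z `|f z.1 - f z.2|%R%:E)); last first.
  by apply: ge0_le_integral_lower => z; rewrite lee_fin//; exact: f1.
have bB := bmeasB bf1 bf2.
have := le_normr_Rintegral measurableT (bmeas_integrable g bB).
rewrite -lee_fin => /le_trans; apply.
by rewrite -EFin_expect//; exact: bmeas_norm.
Qed.

(** The density on pairs of cells given by [cell_transport] yields a coupling
    of P and Q whose cost exceeds the gap of the dual function by an arbitrary
    small amount. *)
Lemma kantorovich_rubinstein (P Q : probability (borel X) R) (K : R) : separable X ->
  (forall f : X -> R, lip1 f -> (forall x, 0 <= f x <= M)%R ->
    \int[P]_x f x <= \int[Q]_x f x + K)%R ->
  W P Q <= K%:E.
Proof.
move=> sX PQ; apply/lee_addgt0Pr => e e0.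
have [L [c [D [w [f [[mc dD] w0 [w2 w1] [f1 fM] cost]]]]]] := cell_transport P Q XM sX e0.
have [g [g1 g2 gE]] := density_coupling mc mc w0 w2 w1.
apply: ge_ereal_inf.
exists (\int[g]_z (mdist (z.1 : X) (z.2 : X))%:E).
  by exists g => // A mA; split; [exact: g1|exact: g2].
apply: (@le_trans _ _ (\int[g]_z (D (c z.1) (c z.2))%:E)).
  by apply: ge0_le_integral_lower => z; rewrite lee_fin ?mdist_ge0.
rewrite EFin_expect ?lee_fin; last first.
  exact: (bmeas_label (fun a => D a.1 a.2) (mlabel_pair mc mc)).
rewrite gE (le_trans cost)// lerD2r lerBlDl; exact: PQ.
Qed.

Lemma d_Lip_le_W_W (Q1 Q2 : probability (borel_prob X) R) : d_Lip Q1 Q2 <= W_W Q1 Q2.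
Proof.
apply: ge_ereal_sup => _ [f f1 <-].
apply: le_ereal_inf_tmp => _ [g gc <-].
pose mean (P : borel_prob X) : R := (\int[P : probability (borel X) R]_x f x)%R.
have mmean : measurable_fun setT mean by exact: measurable_mean (ex_intro _ M XM) f1.
have mPsi : measurable_fun setT (fun z : borel_prob X * borel_prob X => (mean z.1, mean z.2)).
  apply: measurable_fun_pair; exact: measurableT_comp.
pose Psi : {mfun (borel_prob X * borel_prob X)%type >-> (R * R)%type} :=
  HB.pack (fun z : borel_prob X * borel_prob X => (mean z.1, mean z.2))
    (isMeasurableFun.Build _ _ _ _ _ mPsi).
apply: ge_ereal_inf.
exists (\int[distribution g Psi]_z `|z.1 - z.2|%R%:E).
  exists (distribution g Psi) => // A mA.
  have mA' : measurable (mean @^-1` A) by rewrite -[_ @^-1` _]setTI; exact: mmean.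
  by have [h1 h2] := gc _ mA'; split; [exact: h1|exact: h2].
rewrite ge0_integral_distribution//; last first.
  apply/measurable_EFinP; apply: measurableT_comp => //.
  by apply: measurable_funB; [exact: measurable_fst|exact: measurable_snd].
by apply: ge0_le_integral_lower => z //=; exact: mean_gap_le_W.
Qed.

(** Obtained by integrating |x| <= |y| + |x - y| against a coupling; the
    means being nonnegative, both first moments are integrals of nonnegative
    functions. *)
Lemma mean_gap_le_W_real (Q1 Q2 : probability (borel_prob X) R) (f : X -> R) (m1 m2 : R) :
  lip1 f -> (forall x, 0 <= f x)%R ->
  \int[Q1]_P (\int[P : probability (borel X) R]_x f x)%R%:E = m1%:E ->
  \int[Q2]_P (\int[P : probability (borel X) R]_x f x)%R%:E = m2%:E ->
  (m1 - m2)%:E <= W_real (law_of_mean Q1 f) (law_of_mean Q2 f).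
Proof.
move=> f1 f0 E1 E2.
apply: le_ereal_inf_tmp => _ [g gc <-].
pose mean (P : borel_prob X) : R := (\int[P : probability (borel X) R]_x f x)%R.
have mmean : measurable_fun setT mean by exact: measurable_mean (ex_intro _ M XM) f1.
have mean0 P : (0 <= mean P)%R by apply: Rintegral_ge0.
pose mn : {mfun borel_prob X >-> R} := HB.pack mean (isMeasurableFun.Build _ _ _ _ _ mmean).
pose F1 : {mfun (R * R)%type >-> R} :=
  HB.pack fst (isMeasurableFun.Build _ _ _ _ _ (@measurable_fst _ _ R R)).
pose F2 : {mfun (R * R)%type >-> R} :=
  HB.pack snd (isMeasurableFun.Build _ _ _ _ _ (@measurable_snd _ _ R R)).
have nm : measurable_fun [set: R] (fun x => `|x|%R%:E).
  by apply/measurable_EFinP; exact: normr_measurable.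
have H1 : \int[g]_z `|z.1|%R%:E = m1%:E.
  rewrite -E1 -(@ge0_integral_distribution _ _ _ _ _ g F1 (fun x => `|x|%R%:E))//.
  transitivity (\int[distribution Q1 mn]_x `|x|%R%:E).
    by apply: eq_measure_integral => A mA _; have [] := gc A mA.
  rewrite ge0_integral_distribution//; apply: eq_integral => P _ /=.
  by rewrite ger0_norm//; exact: mean0.
have H2 : \int[g]_z `|z.2|%R%:E = m2%:E.
  rewrite -E2 -(@ge0_integral_distribution _ _ _ _ _ g F2 (fun x => `|x|%R%:E))//.
  transitivity (\int[distribution Q2 mn]_x `|x|%R%:E).
    by apply: eq_measure_integral => A mA _; have [] := gc A mA.
  rewrite ge0_integral_distribution//; apply: eq_integral => P _ /=.
  by rewrite ger0_norm//; exact: mean0.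
have mz1 : measurable_fun setT (fun z : R * R => `|z.1|%R%:E).
  by apply/measurable_EFinP; apply: measurableT_comp => //; exact: measurable_fst.
have mz2 : measurable_fun setT (fun z : R * R => `|z.2|%R%:E).
  by apply/measurable_EFinP; apply: measurableT_comp => //; exact: measurable_snd.
have mz12 : measurable_fun setT (fun z : R * R => `|z.1 - z.2|%R%:E).
  apply/measurable_EFinP; apply: measurableT_comp => //.
  by apply: measurable_funB; [exact: measurable_fst|exact: measurable_snd].
rewrite EFinB -H1 leeBlDr ?H2// -H2 -ge0_integralD//.
apply: ge0_le_integral => //; first exact: emeasurable_funD.
move=> z _; rewrite -EFinD lee_fin.
by rewrite -lerBlDr; exact: lerB_dist.
Qed.

End wasserstein_bounds.

(** * Discrete probabilities and their finite truncations *)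

Section countable_sums.
Context (R : realType) (I : countType).
Local Open Scope ereal_scope.

(** Monotone convergence is available for series over nat; the integers that
    encode no index contribute 0. *)
Lemma esum_pickle (a : I -> \bar R) : (forall i, 0 <= a i) ->
  \esum_(i in [set: I]) a i = \sum_(n <oo) oapp a 0 (pickle_inv n).
Proof.
move=> a0; pose b n := oapp a 0 (pickle_inv n).
have b0 n : 0 <= b n by rewrite /b; case: pickle_inv.
rewrite nneseries_esumT//.
transitivity (\esum_(n in range (@choice.pickle I)) b n).
  rewrite (reindex_esum setT (range (@choice.pickle I)) (@choice.pickle I)); last first.
    by apply: inj_bij => i j _ _; exact: (pcan_inj (@choice.pickleK I)).
  by apply: eq_esum => i _; rewrite /b choice.pickleK_inv.
rewrite esum_mkcond; apply: eq_esum => n _; case: ifPn => // /negP nr.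
rewrite /b; case E : (pickle_inv n) => [i|]//=; exfalso; apply: nr; rewrite inE.
by exists i => //; have := @pickle_invK I n; rewrite E.
Qed.

Lemma integral_esum d (T : measurableType d) (m : {measure set T -> \bar R})
    (f : I -> T -> \bar R) :
  (forall i, measurable_fun setT (f i)) -> (forall i x, 0 <= f i x) ->
  \int[m]_x (\esum_(i in [set: I]) f i x) = \esum_(i in [set: I]) \int[m]_x f i x.
Proof.
move=> mf f0; rewrite esum_pickle; last by move=> i; exact: integral_ge0.
under eq_integral do rewrite esum_pickle//.
rewrite integral_nneseries//.
- apply: eq_eseriesr => n _; case: (pickle_inv n) => [i|]//=.
  by rewrite integral0.
- by move=> n; case: (pickle_inv n) => [i|]//=; exact: measurable_cst.
- by move=> n x _; case: (pickle_inv n) => /=.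
Qed.

Lemma measurable_esum d (T : measurableType d) (f : I -> T -> \bar R) :
  (forall i, measurable_fun setT (f i)) -> (forall i x, 0 <= f i x) ->
  measurable_fun setT (fun x => \esum_(i in [set: I]) f i x).
Proof.
move=> mf f0; under eq_fun do rewrite esum_pickle//.
apply: ge0_emeasurable_sum => [n x _ _|n _]; case: (pickle_inv n) => //=.
Qed.

Lemma esum_ge_fset (a : I -> \bar R) (F : {fset I}) : (forall i, 0 <= a i) ->
  \sum_(i : F) a (val i) <= \esum_(i in [set: I]) a i.
Proof.
move=> a0; apply: esum_ge; exists [set` F]; first by split.
by rewrite fsbig_finite//= set_fsetK big_seq_fsetE.
Qed.

Lemma esum_fset_adherent (a : I -> \bar R) (x : \bar R) :
  x < \esum_(i in [set: I]) a i -> exists F : {fset I}, x < \sum_(i : F) a (val i).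
Proof.
move=> /ereal_sup_gt[_ [A [finA _] <-] xA]; exists (fset_set A).
by move: xA; rewrite fsbig_finite// big_seq_fsetE.
Qed.

End countable_sums.

Section discrete_probability.
Context d (T : measurableType d) (R : realType) (I : countType).
Variables (P : probability T R) (a : I -> R) (x : I -> T).
Hypothesis a0 : forall i, 0 <= a i.
Hypothesis PE : forall A, measurable A ->
  P A = (\esum_(i in [set: I]) ((a i)%:E * \d_(x i) A))%E.

(** The measure carried by the atoms of index in F lies below P. *)
Lemma discrete_ge_fset (F : {fset I}) (f : T -> R) :
  bounded_measurable f -> (forall y, 0 <= f y) ->
  \sum_(i : F) a (val i) * f (x (val i)) <= \int[P]_y f y.
Proof.
move=> bf f0; have mf : measurable_fun setT (EFin \o f) by exact/measurable_EFinP/(proj1 bf).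
pose m (i : F) : {measure set T -> \bar R} := mscale (NngNum (a0 (val i))) (dirac (x (val i))).
rewrite -lee_fin -EFin_expect// -sumEFin.
apply: (@le_trans _ _ (\int[fsum_measure m]_y (f y)%:E)%E).
  rewrite integral_fsum_measure//.
  apply: lee_sum => i _; rewrite ge0_integral_mscale//; last by move=> y _; rewrite lee_fin.
  by rewrite integral_dirac// diracT mul1e.
apply: (@ge0_le_measure_integral _ _ _ (fsum_measure m) P) => //.
move=> A mA; rewrite [leLHS](fsum_measureE m A) [leRHS]PE//.
apply: (@esum_ge_fset R I (fun i => (a i)%:E * \d_(x i) A)%E F) => i.
by rewrite mule_ge0// lee_fin.
Qed.

(** The lower bound applied to M - f: the atoms outside F carry the mass
    1 - sum_F a, on which f is at most M. *)
Lemma discrete_le_fset (F : {fset I}) (f : T -> R) M : bounded_measurable f ->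
  (forall y, 0 <= f y <= M) ->
  \int[P]_y f y <= \sum_(i : F) a (val i) * f (x (val i)) + M * (1 - \sum_(i : F) a (val i)).
Proof.
move=> bf fM.
have bMf : bounded_measurable (fun y => M - f y) by exact: bmeasB (bmeas_cst _ _) bf.
have h : \sum_(i : F) a (val i) * (M - f (x (val i))) <= M - \int[P]_y f y.
  rewrite -[M in leRHS](expect_cst P) -expectB//; last exact: bmeas_cst.
  by apply: discrete_ge_fset => // y; have /andP[_] := fM y; rewrite subr_ge0.
move: h; under eq_bigr do rewrite mulrBr.
by rewrite sumrB -mulr_suml; lra.
Qed.

Lemma discrete_sum_le1 (F : {fset I}) : \sum_(i : F) a (val i) <= 1.
Proof.
have := @discrete_ge_fset F (cst 1) (bmeas_cst _ _) (fun=> ler01).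
by rewrite expect_cst; under eq_bigr do rewrite mulr1.
Qed.

Lemma discrete_weight_le1 i : a i <= 1.
Proof.
have := discrete_sum_le1 [fset i]%fset.
by rewrite -(big_seq_fsetE _ [fset i]%fset predT a) big_seq_fset1.
Qed.

Lemma discrete_esum1 : \esum_(i in [set: I]) (a i)%:E = 1%E.
Proof.
rewrite -(@probability_setT _ _ _ P) PE//; apply: eq_esum => i _.
by rewrite diracT mule1.
Qed.

End discrete_probability.

(** * The mean measure of a random probability *)

Section mean_measure.
Context (R : realType) (X : completeMetricType R) (I : countType).
Context d (Omega : measurableType d) (mu : probability Omega R).
Variables (M : R) (XM : forall x y : X, mdist x y <= M).
Variables (Pt : {mfun Omega >-> borel_prob X}) (J : I -> {mfun Omega >-> R}).
Variables (Y : I -> {mfun Omega >-> borel X}) (P : probability (borel X) R).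
Hypotheses (PtE : discrete_random_probability mu Pt J Y).
Hypotheses (JY_indep : indep_families mu J Y) (Y_iid : iid mu Y P).

Definition clamp01 (t : R) : R := Num.max 0 (Num.min 1 t).

Lemma clamp01_itv t : 0 <= clamp01 t <= 1.
Proof. by rewrite /clamp01 le_max lexx/= ge_max ler01/= ge_min lexx. Qed.

Lemma clamp01_id t : 0 <= t <= 1 -> clamp01 t = t.
Proof. by move=> /andP[t0 t1]; rewrite /clamp01 min_r// max_r. Qed.

Lemma bmeas_clamp01 : bounded_measurable clamp01.
Proof.
split; last first.
  by exists 1 => x; have /andP[h0 h1] := clamp01_itv x; rewrite ger0_norm.
apply: measurable_maxr; first exact: measurable_cst.
by apply: measurable_minr; [exact: measurable_cst|exact: measurable_id].
Qed.

(** The jumps lie in the unit interval only almost surely; their truncations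
    are bounded everywhere. *)
Definition jump i w := clamp01 (J i w).

Lemma bmeas_jump i : bounded_measurable (jump i).
Proof. by apply: bmeas_comp; [exact: bmeas_clamp01|]. Qed.

Lemma jump_ge0 i w : 0 <= jump i w.
Proof. by have /andP[] := clamp01_itv (J i w). Qed.

Lemma ae_jump : {ae mu, forall w, (forall i, jump i w = J i w) /\
  (forall A : set (borel X), measurable A -> (Pt w : probability (borel X) R) A =
    (\esum_(i in [set: I]) ((jump i w)%:E * \d_(Y i w) A))%E)}.
Proof.
apply: filterS PtE => w [J0 PE].
have jE i : jump i w = J i w.
  by rewrite /jump clamp01_id// J0 (discrete_weight_le1 J0 PE).
by split => // A mA; rewrite PE//; apply: eq_esum => i _; rewrite jE.
Qed.

Lemma esum_expect_jump : \esum_(i in [set: I]) (\int[mu]_w jump i w)%:E = 1%E.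
Proof.
transitivity (\esum_(i in [set: I]) (\int[mu]_w (jump i w)%:E))%E.
  by apply: eq_esum => i _; rewrite EFin_expect//; exact: bmeas_jump.
have mj i : measurable_fun setT (fun w => (jump i w)%:E).
  by apply/measurable_EFinP; case: (bmeas_jump i).
have j0 i w : (0 <= (jump i w)%:E)%E by rewrite lee_fin jump_ge0.
rewrite -integral_esum//.
rewrite (ae_eq_integral (cst 1%E))//.
- by rewrite integral_cst// mul1e; exact: probability_setT.
- exact: measurable_esum.
- apply: filterS ae_jump => w [_ PE] _.
  exact: (discrete_esum1 PE).
Qed.

Lemma expect_jumps_near1 e : 0 < e -> exists F : {fset I},
  1 - e <= \sum_(i : F) \int[mu]_w jump (val i) w.
Proof.
move=> e0; have [|F hF] := @esum_fset_adherent R I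
  (fun i => (\int[mu]_w jump i w)%:E) (1 - e)%:E.
  by rewrite esum_expect_jump lte_fin; lra.
by exists F; move: hF; rewrite sumEFin lte_fin => /ltW.
Qed.

Lemma expect_jumps_le1 (F : {fset I}) : \sum_(i : F) \int[mu]_w jump (val i) w <= 1.
Proof.
rewrite -expect_sum; last by move=> i; exact: bmeas_jump.
rewrite -[leRHS](expect_cst mu 1); apply: ae_le_expect.
- by apply: bmeas_sum => i; exact: bmeas_jump.
- exact: bmeas_cst.
- apply: filterS ae_jump => w [_ PE].
  exact: (discrete_sum_le1 (fun i => jump_ge0 i w) PE).
Qed.

Lemma jump_atom_law i (A : set R) (B : set (borel X)) : measurable A -> measurable B ->
  mu ((fun w => (J i w, Y i w)) @^-1` (A `*` B)) = (mu (J i @^-1` A) * P B)%E.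
Proof.
move=> mA mB; have [_ /(_ i B mB) <-] := Y_iid.
have cyl d' (T : measurableType d') (C : set T) : measurable C ->
    measurable ((fun x : I -> T => x i) @^-1` C : set (family_space T I)).
  by move=> mC; apply: sub_sigma_algebra; exists i => //; exists C.
exact: (JY_indep (cyl _ _ _ mA) (cyl _ _ _ mB)).
Qed.

(** By independence the law of the pair is a product, to which
    Tonelli's theorem applies. *)
Lemma expect_jump_atom i (f : X -> R) :
  bounded_measurable (f : borel X -> R) -> (forall x, 0 <= f x) ->
  \int[mu]_w (jump i w * f (Y i w)) = \int[mu]_w jump i w * \int[P]_x f x.
Proof.
move=> bf f0.
have mZ : measurable_fun setT (fun w => (J i w, Y i w)) by apply: measurable_fun_pair.
pose Z : {mfun Omega >-> (R * borel X)%type} :=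
  HB.pack (fun w => (J i w, Y i w)) (isMeasurableFun.Build _ _ _ _ _ mZ).
pose h (z : R * borel X) := clamp01 z.1 * f z.2.
have bh : bounded_measurable h.
  exact: bmeasM (bmeas_comp bmeas_clamp01 measurable_fst) (bmeas_comp bf measurable_snd).
have h0 z : (0 <= (h z)%:E)%E.
  by have /andP[? _] := clamp01_itv z.1; rewrite lee_fin mulr_ge0.
have mh : measurable_fun setT (fun z => (h z)%:E) by apply/measurable_EFinP; case: bh.
have b1 : bounded_measurable (fun w => jump i w * f (Y i w)).
  by apply: bmeasM; [exact: bmeas_jump|exact: bmeas_comp].
apply: EFin_inj; rewrite -EFin_expect//.
transitivity (\int[distribution mu Z]_z (h z)%:E)%E.
  by rewrite ge0_integral_distribution.
transitivity (\int[(distribution mu (J i)) \x P]_z (h z)%:E)%E.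
  apply: eq_measure_integral => A mA _; apply/esym.
  apply: product_measure_unique => // B C mB mC.
  by rewrite -jump_atom_law.
rewrite fubini_tonelli1// /fubini_F /h/=.
under eq_integral.
  move=> t _; rewrite EFin_expect; last exact: bmeasZ.
  rewrite expectZ//; over.
rewrite ge0_integral_distribution/=; first last.
- move=> t; have /andP[? _] := clamp01_itv t; rewrite lee_fin mulr_ge0//.
  exact: Rintegral_ge0.
- apply/measurable_EFinP/measurable_funM; last exact: measurable_cst.
  by case: bmeas_clamp01.
rewrite EFin_expect; last by apply: bmeasM; [exact: bmeas_jump|exact: bmeas_cst].
congr EFin; rewrite mulrC -expectZ; last exact: bmeas_jump.
by apply: eq_Rintegral => w _; rewrite mulrC.
Qed.

Definition mean (f : X -> R) (w : Omega) : R :=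
  \int[(Pt w : probability (borel X) R)]_x f x.

Lemma mean_itv f w : lip1 f -> (forall x, 0 <= f x <= M) -> 0 <= mean f w <= M.
Proof.
move=> f1 fM; have bf := lip1_bmeas XM f1.
rewrite Rintegral_ge0/=; last by move=> x _; have /andP[] := fM x.
rewrite -[leRHS](expect_cst (Pt w : probability (borel X) R) M).
by apply: le_expect => // [|x]; [exact: bmeas_cst|have /andP[] := fM x].
Qed.

Lemma bmeas_mean f : lip1 f -> (forall x, 0 <= f x <= M) -> bounded_measurable (mean f).
Proof.
move=> f1 fM; split.
  apply: (measurableT_comp (measurable_mean (ex_intro _ M XM) f1)).
  exact: measurable_funPT.
by exists M => w; have /andP[h0 h1] := mean_itv w f1 fM; rewrite ger0_norm.
Qed.

(** Keeping only the indices of a finite set F, the expectation is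
    (sum_F E J) * P(f) up to M * (1 - sum_F E J), and sum_F E J is close to
    1. *)
Lemma expect_mean f : lip1 f -> (forall x, 0 <= f x <= M) ->
  \int[mu]_w mean f w = \int[P]_x f x.
Proof.
move=> f1 fM; have bf := lip1_bmeas XM f1.
have f0 x : 0 <= f x by have /andP[] := fM x.
have Pf0 : 0 <= \int[P]_x f x by exact: Rintegral_ge0.
have PfM : \int[P]_x f x <= M.
  rewrite -[leRHS](expect_cst P M).
  by apply: le_expect => // [|x]; [exact: bmeas_cst|have /andP[] := fM x].
have bm := bmeas_mean f1 fM.
suff h e : 0 < e -> \int[P]_x f x - M * e <= \int[mu]_w mean f w <= \int[P]_x f x + M * e.
  apply/eqP; rewrite eq_le; apply/andP; split; apply/ler_addgt0Pr => e e0;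
    have M1 : 0 < M + 1 by rewrite ltr_wpDl// (le_trans Pf0).
  - have e' : 0 < e / (M + 1) by rewrite divr_gt0.
    have /andP[_ /le_trans] := h _ e'; apply; rewrite lerD2l mulrA ler_pdivrMr// mulrC.
    by rewrite ler_pM2l//; lra.
  - have e' : 0 < e / (M + 1) by rewrite divr_gt0.
    have /andP[+ _] := h _ e'.
    rewrite lerBlDr => /le_trans; apply; rewrite lerD2l mulrA ler_pdivrMr// mulrC.
    by rewrite ler_pM2l//; lra.
move=> e0; have [F sF] := expect_jumps_near1 e0.
have sF1 := expect_jumps_le1 F.
pose S w := \sum_(i : F) jump (val i) w * f (Y (val i) w).
pose s w := \sum_(i : F) jump (val i) w.
have bS : bounded_measurable S.
  by apply: bmeas_sum => i; apply: bmeasM; [exact: bmeas_jump|exact: bmeas_comp].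
have bs : bounded_measurable s by apply: bmeas_sum => i; exact: bmeas_jump.
have bs' : bounded_measurable (fun w => M * (1 - s w)).
  by apply/bmeasZ/bmeasB => //; exact: bmeas_cst.
have ES : \int[mu]_w S w = (\sum_(i : F) \int[mu]_w jump (val i) w) * \int[P]_x f x.
  rewrite expect_sum => [|i]; last by apply: bmeasM; [exact: bmeas_jump|exact: bmeas_comp].
  by rewrite mulr_suml; apply: eq_bigr => i _; rewrite expect_jump_atom.
have Es : \int[mu]_w (M * (1 - s w)) = M * (1 - \sum_(i : F) \int[mu]_w jump (val i) w).
  rewrite expectZ; last by apply: bmeasB => //; exact: bmeas_cst.
  rewrite expectB ?expect_cst//; last exact: bmeas_cst.
  by rewrite expect_sum// => i; exact: bmeas_jump.
have lo : \int[mu]_w S w <= \int[mu]_w mean f w.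
  apply: ae_le_expect => //; apply: filterS ae_jump => w [_ PE].
  exact: (discrete_ge_fset (fun i => jump_ge0 i w) PE).
have up : \int[mu]_w mean f w <= \int[mu]_w S w + \int[mu]_w (M * (1 - s w)).
  rewrite -expectD//; apply: ae_le_expect => //; first exact: bmeasD.
  apply: filterS ae_jump => w [_ PE].
  exact: (discrete_le_fset (fun i => jump_ge0 i w) PE).
move: lo up; rewrite ES Es.
set sg := \sum_(i : F) _ in sF sF1 *; set m := \int[P]_x f x in Pf0 PfM *.
move=> lo up; apply/andP; split; nra.
Qed.

Lemma expect_mean_distribution f : lip1 f -> (forall x, 0 <= f x <= M) ->
  (\int[distribution mu Pt]_Q (\int[(Q : probability (borel X) R)]_x f x)%R%:E =
   (\int[P]_x f x)%:E)%E.
Proof.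
move=> f1 fM; have bf := lip1_bmeas XM f1.
rewrite -(expect_mean f1 fM) -EFin_expect; last exact: bmeas_mean.
rewrite ge0_integral_distribution//.
  by apply/measurable_EFinP; exact: measurable_mean (ex_intro _ M XM) f1.
by move=> Q; rewrite lee_fin; apply: Rintegral_ge0 => x _; have /andP[] := fM x.
Qed.

End mean_measure.

(** * Labels of the jumps and of the atoms *)

Section product_sums.
Context (R : realType) (K L : finType).

Lemma sum_ffun2_prod (F : K -> L -> L -> R) :
  \sum_(f : {ffun K -> L}) \sum_(g : {ffun K -> L}) \prod_j F j (f j) (g j) =
  \prod_j \sum_a \sum_b F j a b.
Proof.
rewrite bigA_distr_bigA/=; apply: eq_bigr => f _.
by rewrite bigA_distr_bigA.
Qed.

(** Under the product of copies of pi, a function of one coordinate keeps its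
    expectation under pi. *)
Lemma sum_ffun2_prod_coord (pi D : L -> L -> R) (i : K) : \sum_a \sum_b pi a b = 1 ->
  \sum_(f : {ffun K -> L}) \sum_(g : {ffun K -> L})
    (\prod_j pi (f j) (g j)) * D (f i) (g i) = \sum_a \sum_b pi a b * D a b.
Proof.
move=> pi1.
transitivity (\sum_(f : {ffun K -> L}) \sum_(g : {ffun K -> L})
    \prod_j (pi (f j) (g j) * (if j == i then D (f j) (g j) else 1))).
  apply: eq_bigr => f _; apply: eq_bigr => g _; rewrite big_split/=; congr (_ * _).
  by rewrite -big_mkcond big_pred1_eq.
rewrite (sum_ffun2_prod (fun j a b => pi a b * (if j == i then D a b else 1))).
rewrite (bigD1 i)//= eqxx [X in _ * X]big1 ?mulr1// => j /negbTE ->.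
by rewrite -[RHS]pi1; apply: eq_bigr => a _; apply: eq_bigr => b _; rewrite mulr1.
Qed.

End product_sums.

Section family_labels.
Context (R : realType) (I : countType) (F : {fset I}).

Definition family_label (T : Type) (L : finType) (h : T -> L) (x : I -> T) : {ffun F -> L} :=
  [ffun j => h (x (val j))].

Lemma mlabel_family d (T : measurableType d) (L : finType) (h : T -> L) : measurable_label h ->
  measurable_label (family_label h : family_space T I -> _).
Proof.
move=> mh a; rewrite (_ : _ @^-1` _ = \bigcap_(j in [set: F])
    ((fun x => x (val j)) @^-1` (h @^-1` [set a j]))).
  apply: fin_bigcap_measurable => // j _; apply: sub_sigma_algebra.
  by exists (val j) => //; exists (h @^-1` [set a j]).
apply/seteqP; split => x /=; first by move=> <- j _ /=; rewrite ffunE.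
by move=> xa; apply/ffunP => j; rewrite ffunE; exact: xa.
Qed.

Context d (Omega : measurableType d) (mu : probability Omega R).

Lemma mlabel_joint d' (T : measurableType d') (L : finType) (h : T -> L)
    (Y : I -> {mfun Omega >-> T}) : measurable_label h ->
  measurable_label (family_label h \o joint Y).
Proof.
move=> mh a; rewrite (_ : _ @^-1` _ = \bigcap_(j in [set: F])
    (Y (val j) @^-1` (h @^-1` [set a j]))).
  by apply: fin_bigcap_measurable => // j _; rewrite -[_ @^-1` _]setTI; exact: measurable_funPT.
apply/seteqP; split => x /=; first by move=> <- j _ /=; rewrite ffunE.
by move=> xa; apply/ffunP => j; rewrite ffunE; exact: xa.
Qed.

(** Coordinates outside F are left free, so that the event is one of the
    finite intersections for which independence is stated. *)
Lemma iid_family_label d' (T : measurableType d') (L : finType) (h : T -> L)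
    (Y : I -> {mfun Omega >-> T}) (P : probability T R) (a : {ffun F -> L}) :
  measurable_label h -> iid mu Y P ->
  label_prob mu (family_label h \o joint Y) a = \prod_j label_prob P h (a j).
Proof.
move=> mh [ind law]; pose A i := if insub i is Some j then h @^-1` [set a j] else setT.
have mA i : measurable (A i) by rewrite /A; case: insubP.
rewrite /label_prob (_ : _ @^-1` _ = \bigcap_(i in [set` F]) (Y i @^-1` A i)); last first.
  apply/seteqP; split => x /=.
    by move=> xa i iF; rewrite /A insubT/= -xa/= ffunE.
  by move=> xa; apply/ffunP => j; rewrite ffunE; have := xa (val j) (valP j); rewrite /A/= valK.
rewrite ind// big_seq_fsetE/=.
transitivity (fine (\prod_(j : F) (label_prob P h (a j))%:E)%E); last by rewrite prodEFin.
congr fine; apply: eq_bigr => j _.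
have -> : A (val j) = h @^-1` [set a j] by rewrite /A valK.
have := law (val j) _ (mh (a j)); rewrite /distribution/= /pushforward => ->.
by rewrite fineK// fin_num_measure.
Qed.

End family_labels.

Section jump_atom_labels.
Context (R : realType) (X : completeMetricType R) (I : countType) (F : {fset I}).
Context d (Omega : measurableType d) (mu : probability Omega R).
Context (J : I -> {mfun Omega >-> R}) (Y : I -> {mfun Omega >-> borel X}).
Context (P : probability (borel X) R).
Context (LJ LX : finType) (k : R -> LJ) (c : borel X -> LX).
Hypotheses (mk : measurable_label k) (mc : measurable_label c).

Definition jump_label : Omega -> {ffun F -> LJ} := family_label F k \o joint J.
Definition atom_label : Omega -> {ffun F -> LX} := family_label F c \o joint Y.
Definition jump_atom_label w := (jump_label w, atom_label w).

Lemma jump_atom_label_preimage a : jump_atom_label @^-1` [set a] =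
  jump_label @^-1` [set a.1] `&` atom_label @^-1` [set a.2].
Proof.
by case: a => a b; apply/seteqP; split => x /=; [case=> -> ->|case=> <- <-].
Qed.

Lemma mlabel_jump_atom : measurable_label jump_atom_label.
Proof.
by move=> a; rewrite jump_atom_label_preimage; apply: measurableI; exact: mlabel_joint.
Qed.

Lemma jump_atom_label_prob a : indep_families mu J Y -> iid mu Y P ->
  label_prob mu jump_atom_label a =
  label_prob mu jump_label a.1 * \prod_j label_prob P c (a.2 j).
Proof.
move=> JY Yiid; rewrite -(iid_family_label _ mc Yiid).
rewrite /label_prob jump_atom_label_preimage.
have := JY _ _ (mlabel_family mk a.1) (mlabel_family mc a.2) => h.
rewrite -fineM; first by congr fine; exact: h.
  exact: fin_num_measure (mlabel_joint _ _ _).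
exact: fin_num_measure (mlabel_joint _ _ _).
Qed.

End jump_atom_labels.

(** * Densities that synchronize the labels *)

Section synchronous_density.
Context (R : realType) (A K L : finType).
Variables (r : A -> R) (p q : L -> R) (w : L -> L -> R).
Hypotheses (r0 : forall a, 0 <= r a) (r1 : \sum_a r a = 1).
Hypotheses (w0 : forall a b, 0 <= w a b).
Hypotheses (w2 : forall a, \sum_b w a b * q b = 1) (w1 : forall b, \sum_a w a b * p a = 1).

(** The density is the product of the one of the diagonal plan of r with
    itself and of one copy of w per index: it makes the A-labels equal and
    distributes the pairs of L-labels independently according to the plan of
    density w. *)
Lemma synchronous_density : exists W : A * {ffun K -> L} -> A * {ffun K -> L} -> R,
  [/\ forall a b, 0 <= W a b,
      forall a, \sum_b W a b * (r b.1 * \prod_j q (b.2 j)) = 1,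
      forall b, \sum_a W a b * (r a.1 * \prod_j p (a.2 j)) = 1 &
      forall G, \sum_a \sum_b W a b *
          ((r a.1 * \prod_j p (a.2 j)) * (r b.1 * \prod_j q (b.2 j))) * G a b =
        \sum_a r a * \sum_(f : {ffun K -> L}) \sum_(g : {ffun K -> L})
          (\prod_j (w (f j) (g j) * (p (f j) * q (g j)))) * G (a, f) (a, g)].
Proof.
have diag0 a b : 0 <= (if a == b then r a else 0) by case: ifP.
have diag1 a : \sum_b (if a == b then r a else 0) = r a.
  by rewrite -big_mkcond/= (big_pred1 a)// => b; rewrite eq_sym.
have diag2 b : \sum_a (if a == b then r a else 0) = r b.
  by rewrite -big_mkcond/= big_pred1_eq.
have [s [s0 s2 s1 sE]] := transport_density r0 r0 r1 r1 diag0 diag1 diag2.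
exists (fun a b : A * {ffun K -> L} => s a.1 b.1 * \prod_j w (a.2 j) (b.2 j)); split.
- by move=> a b; rewrite mulr_ge0// prodr_ge0.
- move=> [a f]/=; rewrite -(pair_bigA _ (fun b (g : {ffun K -> L}) =>
    s a b * (\prod_j w (f j) (g j)) * (r b * \prod_j q (g j))))/=.
  transitivity (\sum_b s a b * r b); last exact: s2.
  apply: eq_bigr => b _; under eq_bigr do rewrite mulrACA -big_split/=.
  rewrite -mulr_sumr -(bigA_distr_bigA (fun j c => w (f j) c * q c))/=.
  by rewrite big1 ?mulr1.
- move=> [b g]/=; rewrite -(pair_bigA _ (fun a (f : {ffun K -> L}) =>
    s a b * (\prod_j w (f j) (g j)) * (r a * \prod_j p (f j))))/=.
  transitivity (\sum_a s a b * r a); last exact: s1.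
  apply: eq_bigr => a _; under eq_bigr do rewrite mulrACA -big_split/=.
  rewrite -mulr_sumr -(bigA_distr_bigA (fun j c => w c (g j) * p c))/=.
  by rewrite big1 ?mulr1.
move=> G.
pose H a b (f g : {ffun K -> L}) := s a b * (r a * r b) *
  ((\prod_j (w (f j) (g j) * (p (f j) * q (g j)))) * G (a, f) (b, g)).
transitivity (\sum_a \sum_f \sum_b \sum_g H a b f g).
  rewrite [RHS]pair_bigA/=; apply: eq_bigr => -[a f] _ /=.
  rewrite [RHS]pair_bigA/=; apply: eq_bigr => -[b g] _ /=.
  by rewrite /H !big_split/=; ring.
apply: eq_bigr => a _; rewrite mulr_sumr; apply: eq_bigr => f _.
rewrite (bigD1 a)//= [X in _ + X]big1 ?addr0 => [|b /negbTE ba].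
  by rewrite mulr_sumr; apply: eq_bigr => g _; rewrite /H sE eqxx.
by rewrite big1// => g _; rewrite /H sE eq_sym ba mul0r.
Qed.

End synchronous_density.

Lemma negligible_coupling (R : realType) d1 d2 (O1 : measurableType d1) (O2 : measurableType d2)
    (g : probability (O1 * O2)%type R) (mu1 : probability O1 R) (mu2 : probability O2 R)
    (Q1 : O1 -> Prop) (Q2 : O2 -> Prop) :
  (forall A, measurable A -> g (fst @^-1` A) = mu1 A) ->
  (forall B, measurable B -> g (snd @^-1` B) = mu2 B) ->
  {ae mu1, forall x, Q1 x} -> {ae mu2, forall y, Q2 y} ->
  {ae g, forall z, Q1 z.1 /\ Q2 z.2}.
Proof.
move=> g1 g2 [N1 [mN1 N10 QN1]] [N2 [mN2 N20 QN2]].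
have h1 : {ae g, forall z, Q1 z.1}.
  exists (fst @^-1` N1); split; [|by rewrite g1|by move=> z; exact: QN1].
  by rewrite -[_ @^-1` _]setTI; exact: measurable_fst.
have h2 : {ae g, forall z, Q2 z.2}.
  exists (snd @^-1` N2); split; [|by rewrite g2|by move=> z; exact: QN2].
  by rewrite -[_ @^-1` _]setTI; exact: measurable_snd.
by apply: filterS2 h1 h2.
Qed.

(** * The synchronous coupling of two random probabilities *)

Section discrete_gap.
Context (R : realType) (X : completeMetricType R) (I : countType).
Variables (M : R) (XM : forall x y : X, mdist x y <= M).

(** Splits each difference a f(x) - b f(y) as
    a (f(x) - f(y)) + (a - b) f(y), and bounds the mass of P outside F by
    1 - sum t. *)
Lemma discrete_gap (P Q : probability (borel X) R) (a b : I -> R) (x y : I -> borel X)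
    (F : {fset I}) (e : R) (t dl : F -> R) (f : X -> R) :
  (forall i, 0 <= a i) -> (forall i, 0 <= b i) ->
  (forall A : set (borel X), measurable A ->
    P A = (\esum_(i in [set: I]) ((a i)%:E * \d_(x i) A))%E) ->
  (forall A : set (borel X), measurable A ->
    Q A = (\esum_(i in [set: I]) ((b i)%:E * \d_(y i) A))%E) ->
  (forall j, t j <= a (val j) <= t j + e) -> (forall j, t j <= b (val j) <= t j + e) ->
  (forall j, mdist (x (val j) : X) (y (val j)) <= dl j) ->
  lip1 f -> (forall z, 0 <= f z <= M) ->
  \int[P]_z f z <= \int[Q]_z f z +
    (\sum_j ((t j + e) * dl j + e * M) + M * (1 - \sum_j t j)).
Proof.
move=> a0 b0 PE QE ta tb xy f1 fM; have bf := lip1_bmeas XM f1.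
have f0 z : 0 <= f z by have /andP[] := fM z.
have M0 : 0 <= M by exact: le_trans (mdist_ge0 _ _) (XM point point).
have hP := discrete_le_fset a0 PE F bf fM.
have hQ := discrete_ge_fset b0 QE F bf f0.
have : \sum_(j : F) a (val j) * f (x (val j)) <=
    \sum_(j : F) b (val j) * f (y (val j)) + \sum_j ((t j + e) * dl j + e * M).
  rewrite -big_split/=; apply: ler_sum => j _.
  have /andP[ta1 ta2] := ta j; have /andP[tb1 tb2] := tb j.
  have h1 : a (val j) * (f (x (val j)) - f (y (val j))) <= (t j + e) * dl j.
    apply: (@le_trans _ _ (a (val j) * dl j)).
      rewrite ler_wpM2l// (le_trans (ler_norm _))// (le_trans (f1 _ _))//.
    by rewrite ler_wpM2r// (le_trans (mdist_ge0 _ _) (xy j)).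
  have h2 : (a (val j) - b (val j)) * f (y (val j)) <= e * M.
    have /andP[fy0 fyM] := fM (y (val j)).
    have e0 : 0 <= e by lra.
    apply: (@le_trans _ _ (e * f (y (val j)))); last by rewrite ler_wpM2l.
    rewrite ler_wpM2r//; lra.
  move: h1 h2; rewrite mulrBr mulrBl; lra.
have : \sum_j t j <= \sum_(j : F) a (val j) by apply: ler_sum => j _; have /andP[] := ta j.
move=> /(ler_wpM2l M0); move: hP hQ; rewrite !mulrBr; lra.
Qed.

End discrete_gap.

Section synchronous_coupling.
Context (R : realType) (X : completeMetricType R) (I : countType).
Variables (M : R) (XM : forall x y : X, mdist x y <= M) (X_separable : separable X).
Context d1 (Omega1 : measurableType d1) (mu1 : probability Omega1 R).
Context d2 (Omega2 : measurableType d2) (mu2 : probability Omega2 R).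
Context (Pt1 : {mfun Omega1 >-> borel_prob X}) (Pt2 : {mfun Omega2 >-> borel_prob X}).
Context (J1 : I -> {mfun Omega1 >-> R}) (J2 : I -> {mfun Omega2 >-> R}).
Context (X1 : I -> {mfun Omega1 >-> borel X}) (X2 : I -> {mfun Omega2 >-> borel X}).
Context (P1 P2 : probability (borel X) R).
Hypotheses (Pt1E : discrete_random_probability mu1 Pt1 J1 X1).
Hypotheses (Pt2E : discrete_random_probability mu2 Pt2 J2 X2).
Hypotheses (J1_X1_indep : indep_families mu1 J1 X1).
Hypotheses (J2_X2_indep : indep_families mu2 J2 X2).
Hypotheses (X1_iid : iid mu1 X1 P1) (X2_iid : iid mu2 X2 P2).
Hypotheses (J1_J2_law : same_joint_law mu1 mu2 J1 J2).

(** The probabilities [mu1] and [mu2] are coupled through the labels of the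
    jumps and atoms of index in F, with the density of [synchronous_density].
    When the rounded jumps agree, [discrete_gap] bounds the cost by a sum over
    F, whose expectation factorizes into the expected rounded jumps and the
    transport cost of one pair of cells. *)
Lemma W_W_le_transport (L : finType) (c : borel X -> L) (D w : L -> L -> R) (C : R)
    (F : {fset I}) (e : R) :
  measurable_label c -> (forall x y : X, mdist x y <= D (c x) (c y)) ->
  (forall a b, 0 <= w a b) ->
  (forall a, \sum_b w a b * label_prob P2 c b = 1) ->
  (forall b, \sum_a w a b * label_prob P1 c a = 1) ->
  \sum_a \sum_b w a b * (label_prob P1 c a * label_prob P2 c b) * D a b <= C ->
  0 <= C -> 0 < e ->
  (W_W (distribution mu1 Pt1) (distribution mu2 Pt2) <=
   ((1 + #|{: F}|%:R * e) * C + 2 * (#|{: F}|%:R * e * M) +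
    M * (1 - \sum_(i : F) \int[mu1]_x jump J1 (val i) x))%:E)%E.
Proof.
move=> mc dD w0 w2 w1 wC C0 e0.
have M0 : 0 <= M by exact: le_trans (mdist_ge0 _ _) (XM point point).
have [LJ [k [t [mk tk]]]] := grid_label e0.
pose u1 := jump_atom_label F J1 X1 k c; pose u2 := jump_atom_label F J2 X2 k c.
have mu1' : measurable_label u1 by exact: mlabel_jump_atom.
have mu2' : measurable_label u2 by exact: mlabel_jump_atom.
have mj1 : measurable_label (jump_label F J1 k) by exact: mlabel_joint.
pose r := label_prob mu1 (jump_label F J1 k).
have rE : label_prob mu2 (jump_label F J2 k) = r.
  apply/funext => a; rewrite /r /label_prob; congr fine; apply/esym.
  exact: (J1_J2_law (mlabel_family mk a)).
pose p := label_prob P1 c; pose q := label_prob P2 c.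
have r0 a : 0 <= r a by exact: label_prob_ge0.
have r1 : \sum_a r a = 1 by exact: label_prob_sum1.
have [rho [rho0 rho2 rho1 rhoE]] := @synchronous_density R _ F L r p q w r0 r1 w0 w2 w1.
have u1E a : label_prob mu1 u1 a = r a.1 * \prod_j p (a.2 j).
  exact: jump_atom_label_prob.
have u2E a : label_prob mu2 u2 a = r a.1 * \prod_j q (a.2 j).
  by rewrite -rE; exact: jump_atom_label_prob.
have [g [g1 g2 gE]] : exists g : probability (Omega1 * Omega2)%type R,
  [/\ forall A, measurable A -> g (fst @^-1` A) = mu1 A,
      forall B, measurable B -> g (snd @^-1` B) = mu2 B &
      forall G, \int[g]_z G (u1 z.1) (u2 z.2) =
       \sum_a \sum_b rho a b * (label_prob mu1 u1 a * label_prob mu2 u2 b) * G a b].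
  apply: density_coupling => // a.
    by under eq_bigr do rewrite u2E.
  by under eq_bigr do rewrite u1E.
(* Pairs of labels with different rounded jumps carry no mass, so that the
   trivial bound M is good enough there. *)
pose G (a b : {ffun F -> LJ} * {ffun F -> L}) : R :=
  if a.1 == b.1 then
    \sum_j ((t (a.1 j) + e) * D (a.2 j) (b.2 j) + e * M) + M * (1 - \sum_j t (a.1 j))
  else M.
have mPhi : measurable_fun setT (fun z : Omega1 * Omega2 => (Pt1 z.1, Pt2 z.2)).
  by apply: measurable_fun_pair; apply: measurableT_comp.
pose Phi : {mfun (Omega1 * Omega2)%type >-> (borel_prob X * borel_prob X)%type} :=
  HB.pack (fun z : Omega1 * Omega2 => (Pt1 z.1, Pt2 z.2))
    (isMeasurableFun.Build _ _ _ _ _ mPhi).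
have tkj (z : R) : clamp01 z = z -> t (k z) <= clamp01 z <= t (k z) + e.
  by move=> zE; rewrite zE; apply: tk; rewrite -zE; exact: clamp01_itv.
have Wbound : {ae g, forall z, (W (Pt1 z.1) (Pt2 z.2) <= (G (u1 z.1) (u2 z.2))%:E)%E}.
  apply: filterS (negligible_coupling g1 g2 (ae_jump Pt1E) (ae_jump Pt2E)).
  move=> -[x y]/= [[j1 PE1] [j2 PE2]].
  apply: kantorovich_rubinstein => // f f1 fM; rewrite /G; case: ifPn => [/eqP lab|_].
    apply: (discrete_gap XM (fun i => jump_ge0 J1 i x) (fun i => jump_ge0 J2 i y)
      PE1 PE2) => // j.
    - by rewrite ffunE; apply: tkj; exact: j1.
    - by rewrite lab ffunE; apply: tkj; exact: j2.
    - by rewrite !ffunE; exact: dD.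
  have /andP[_ h1] := mean_itv XM Pt1 x f1 fM.
  have /andP[h2 _] := mean_itv XM Pt2 y f1 fM.
  by rewrite (le_trans h1)// lerDr.
apply: (@le_trans _ _ (\int[distribution g Phi]_z W z.1 z.2)%E).
  apply: ge_ereal_inf; eexists; last exact: lexx.
  exists (distribution g Phi) => // A mA.
  have mA1 : measurable (Pt1 @^-1` A) by rewrite -[_ @^-1` _]setTI; exact: measurable_funPT.
  have mA2 : measurable (Pt2 @^-1` A) by rewrite -[_ @^-1` _]setTI; exact: measurable_funPT.
  by split; [exact: (g1 _ mA1)|exact: (g2 _ mA2)].
apply: (le_trans (@integral_distribution_le _ _ R _ _ g Phi (fun z => W z.1 z.2)
  (fun z => G (u1 z.1) (u2 z.2)) _ _ Wbound)).
- by move=> z; exact: W_ge0.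
- exact: (bmeas_label (fun a => G a.1 a.2) (mlabel_pair mu1' mu2')).
rewrite lee_fin gE.
under eq_bigr do under eq_bigr do rewrite u1E u2E.
rewrite rhoE.
pose n : R := #|{: F}|%:R; pose s (a : {ffun F -> LJ}) := \sum_j t (a j).
pose pi a b := w a b * (p a * q b).
have pi1 : \sum_a \sum_b pi a b = 1.
  rewrite -(label_prob_sum1 P1 mc); apply: eq_bigr => a _.
  rewrite -[RHS]mul1r -(w2 a) mulr_suml; apply: eq_bigr => b _.
  by rewrite /pi mulrCA mulrC.
pose S := \sum_a \sum_b pi a b * D a b.
have inner a : \sum_(f : {ffun F -> L}) \sum_(h : {ffun F -> L})
      (\prod_j pi (f j) (h j)) * G (a, f) (a, h) =
    (s a + n * e) * S + (n * e * M + M * (1 - s a)).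
  transitivity (\sum_(f : {ffun F -> L}) \sum_(h : {ffun F -> L})
      (\sum_i (t (a i) + e) * ((\prod_j pi (f j) (h j)) * D (f i) (h i)) +
       (\prod_j pi (f j) (h j)) * (n * e * M + M * (1 - s a)))).
    apply: eq_bigr => f _; apply: eq_bigr => h _; rewrite /G/= eqxx [X in X + _]big_split/=.
    rewrite sumr_const -mulr_natl -/n -/(s a) -addrA mulrDr mulr_sumr; congr (_ + _).
      by apply: eq_bigr => i _; rewrite mulrCA.
    by rewrite mulrA.
  under eq_bigr do rewrite big_split/=.
  rewrite big_split/=; congr (_ + _).
    under eq_bigr do rewrite exchange_big/=.
    rewrite exchange_big/=.
    transitivity (\sum_i (t (a i) + e) * S).
      apply: eq_bigr => i _; under eq_bigr do rewrite -mulr_sumr.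
      by rewrite -mulr_sumr sum_ffun2_prod_coord.
    by rewrite -mulr_suml big_split/= sumr_const -mulr_natl.
  under eq_bigr do rewrite -mulr_suml.
  rewrite -mulr_suml (sum_ffun2_prod (fun=> pi)).
  by rewrite [X in X * _]big1 ?mul1r// => i _; exact: pi1.
under eq_bigr do rewrite inner.
pose tau := \sum_a s a * r a.
have tauE : tau = \int[mu1]_x s (jump_label F J1 k x) by rewrite (expect_label mu1 s mj1).
have -> : \sum_a r a * ((s a + n * e) * S + (n * e * M + M * (1 - s a))) =
    (tau + n * e) * S + n * e * M + M * (1 - tau).
  transitivity (\sum_a (s a * r a * (S - M) + r a * (n * e * S + n * e * M + M))).
    by apply: eq_bigr => a _; ring.
  by rewrite big_split/= -!mulr_suml r1 -/tau; ring.
set sF := \sum_(i : F) _.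
have bs : bounded_measurable (fun x => s (jump_label F J1 k x)) by exact: bmeas_label.
have bj : bounded_measurable (fun x => \sum_(i : F) jump J1 (val i) x).
  by apply: bmeas_sum => i; exact: bmeas_jump.
have sFE : sF = \int[mu1]_x \sum_(i : F) jump J1 (val i) x.
  by rewrite expect_sum// => i; exact: bmeas_jump.
have grid : {ae mu1, forall x, forall i : F,
    t (jump_label F J1 k x i) <= jump J1 (val i) x <= t (jump_label F J1 k x i) + e}.
  apply: filterS (ae_jump Pt1E) => x [j1 _] i; rewrite ffunE.
  by apply: tkj; exact: j1.
have tau_le : tau <= sF.
  rewrite tauE sFE; apply: ae_le_expect => //; apply: filterS grid => x tx.
  by apply: ler_sum => i _; have /andP[] := tx i.
have tau_ge : sF <= tau + n * e.
  rewrite tauE sFE -[n * e](expect_cst mu1) -expectD//; last exact: bmeas_cst.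
  apply: ae_le_expect => //; first by apply: bmeasD => //; exact: bmeas_cst.
  apply: filterS grid => x tx.
  rewrite /n mulr_natl -sumr_const -big_split/=.
  by apply: ler_sum => i _; have /andP[] := tx i.
have sF1 : sF <= 1 by exact: (expect_jumps_le1 Pt1E).
have sF0 : 0 <= sF.
  by apply: sumr_ge0 => i _; apply: Rintegral_ge0 => x _; exact: jump_ge0.
have n0 : 0 <= n * e by rewrite mulr_ge0// ltW.
have h1 : (tau + n * e) * S <= (1 + n * e) * C.
  apply: (@le_trans _ _ ((tau + n * e) * C)).
    by rewrite ler_wpM2l// (le_trans sF0).
  by rewrite ler_wpM2r// lerD2r (le_trans tau_le).
have h2 : M * (1 - tau) <= M * (1 - sF + n * e) by rewrite ler_wpM2l//; lra.
rewrite -/n; move: h1 h2; lra.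
Qed.

End synchronous_coupling.

(** * Equality of the three distances *)

Section main_bounds.
Context (R : realType) (X : completeMetricType R) (I : countType).
Variables (M : R) (XM : forall x y : X, mdist x y <= M) (X_separable : separable X).
Context d1 (Omega1 : measurableType d1) (mu1 : probability Omega1 R).
Context d2 (Omega2 : measurableType d2) (mu2 : probability Omega2 R).
Context (Pt1 : {mfun Omega1 >-> borel_prob X}) (Pt2 : {mfun Omega2 >-> borel_prob X}).
Context (J1 : I -> {mfun Omega1 >-> R}) (J2 : I -> {mfun Omega2 >-> R}).
Context (X1 : I -> {mfun Omega1 >-> borel X}) (X2 : I -> {mfun Omega2 >-> borel X}).
Context (P1 P2 : probability (borel X) R).
Hypotheses (Pt1E : discrete_random_probability mu1 Pt1 J1 X1).
Hypotheses (Pt2E : discrete_random_probability mu2 Pt2 J2 X2).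
Hypotheses (J1_X1_indep : indep_families mu1 J1 X1).
Hypotheses (J2_X2_indep : indep_families mu2 J2 X2).
Hypotheses (X1_iid : iid mu1 X1 P1) (X2_iid : iid mu2 X2 P2).
Local Open Scope ereal_scope.

(** If d_Lip is finite it is an admissible constant in Kantorovich duality;
    it cannot be - oo, as the zero function shows. *)
Lemma W_le_d_Lip : W P1 P2 <= d_Lip (distribution mu1 Pt1) (distribution mu2 Pt2).
Proof.
have gap (f : X -> R) : lip1 f -> (forall x, (0 <= f x <= M)%R) ->
    (\int[P1]_x f x - \int[P2]_x f x)%R%:E <=
    d_Lip (distribution mu1 Pt1) (distribution mu2 Pt2).
  move=> f1 fM; apply: (@le_trans _ _ (W_real
      (law_of_mean (distribution mu1 Pt1) f) (law_of_mean (distribution mu2 Pt2) f))).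
    apply: (mean_gap_le_W_real XM f1).
    - by move=> x; have /andP[] := fM x.
    - exact: (expect_mean_distribution XM Pt1E J1_X1_indep X1_iid f1 fM).
    - exact: (expect_mean_distribution XM Pt2E J2_X2_indep X2_iid f1 fM).
  by apply: le_ereal_sup_tmp; eexists; last exact: lexx; exists f.
move: gap; case: (d_Lip _ _) => [K| |] gap; last 2 first.
- exact: leey.
- have M0 : (0 <= M)%R by exact: le_trans (mdist_ge0 _ _) (XM point point).
  have l0 : lip1 (fun _ : X => 0%R : R) by move=> x y; rewrite subrr normr0 mdist_ge0.
  by have := gap _ l0; rewrite lexx M0 => /(_ (fun=> isT)).
- apply: (kantorovich_rubinstein XM) => // f f1 fM.
  by have := gap f f1 fM; rewrite lee_fin lerBlDl.
Qed.

(** In [W_W_le_transport], F is chosen first so as to carry the mass 1 - h,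
    and the mesh e' of the grid afterwards, since the rounding error is
    multiplied by the number of indices in F. *)
Lemma W_W_le_W : same_joint_law mu1 mu2 J1 J2 ->
  W_W (distribution mu1 Pt1) (distribution mu2 Pt2) <= W P1 P2.
Proof.
move=> J1_J2_law.
have M0 : (0 <= M)%R by exact: le_trans (mdist_ge0 _ _) (XM point point).
have WM : W P1 P2 <= M%:E.
  apply: (kantorovich_rubinstein XM) => // f f1 fM.
  have bf := lip1_bmeas XM f1.
  have h1 : (\int[P1]_x f x <= M)%R.
    rewrite -[leRHS](expect_cst P1 M).
    by apply: le_expect => // [|x]; [exact: bmeas_cst|have /andP[] := fM x].
  rewrite (le_trans h1)// lerDr.
  by apply: Rintegral_ge0 => x _; have /andP[] := fM x.
have W0 := W_ge0 P1 P2.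
have Wfin : W P1 P2 \is a fin_num by rewrite ge0_fin_numE// (le_lt_trans WM) ?ltry.
pose Wr := fine (W P1 P2); have WE : W P1 P2 = Wr%:E by rewrite fineK.
have Wr0 : (0 <= Wr)%R by exact: fine_ge0.
apply/lee_addgt0Pr => e e0; rewrite WE.
(* The total excess over W(P1, P2) is at most c h when h <= 1. *)
pose c : R := (2 + Wr + 3 * M)%R; have c0 : (0 < c)%R by rewrite /c; lra.
pose h : R := Num.min 1%R (e / c)%R.
have h0 : (0 < h)%R by rewrite lt_min ltr01 divr_gt0.
have h1 : (h <= 1)%R by rewrite ge_min lexx.
have hc : (h * c <= e)%R by rewrite -ler_pdivlMr// ge_min lexx orbT.
have [L [lb [D [w [f [[mlb dD] w0 [w2 w1] [f1 fM] cost]]]]]] :=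
  cell_transport P1 P2 XM X_separable h0.
have gapW : (\int[P1]_x f x - \int[P2]_x f x + h <= Wr + h)%R.
  rewrite lerD2r -lee_fin -WE (le_trans _ (mean_gap_le_W XM P1 P2 f1))//.
  by rewrite lee_fin ler_norm.
have [F sF] := expect_jumps_near1 Pt1E h0.
pose n : R := #|{: F}|%:R; have n0 : (0 <= n)%R by exact: ler0n.
pose e' : R := (h / (n + 1))%R.
have n1 : (0 < n + 1)%R by lra.
have e'0 : (0 < e')%R by rewrite divr_gt0.
have ne' : (n * e' <= h)%R.
  rewrite /e' mulrA ler_pdivrMr// mulrC ler_pM2l//; lra.
have C0 : (0 <= Wr + h)%R by rewrite addr_ge0// ltW.
have := W_W_le_transport XM X_separable Pt1E Pt2E J1_X1_indep J2_X2_indep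
  X1_iid X2_iid J1_J2_law F mlb dD w0 w2 w1 (le_trans cost gapW) C0 e'0.
move=> /le_trans; apply; rewrite -EFinD lee_fin -/n.
set sF' := (\sum_(i : F) _)%R in sF *.
have b1 : (M * (1 - sF') <= M * h)%R by rewrite ler_wpM2l//; lra.
have b2 : (n * e' * M <= h * M)%R by rewrite ler_wpM2r.
have b3 : (n * e' * (Wr + h) <= h * (Wr + 1))%R.
  by apply: ler_pM => //; [exact: mulr_ge0 n0 (ltW e'0)|rewrite lerD2l].
move: hc; rewrite /c !mulrDr !mulrDl; move: b1 b2 b3; lra.
Qed.

End main_bounds.

Theorem theorem3p5 (R : realType) (X : completeMetricType R)
    (X_separable : separable X) (X_bounded : bounded_diameter X)
    (I : countType)
    (d1 : measure_display) (Omega1 : measurableType d1)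
    (mu1 : probability Omega1 R)
    (d2 : measure_display) (Omega2 : measurableType d2)
    (mu2 : probability Omega2 R)
    (Pt1 : {mfun Omega1 >-> borel_prob X}) (Pt2 : {mfun Omega2 >-> borel_prob X})
    (J1 : I -> {mfun Omega1 >-> R}) (J2 : I -> {mfun Omega2 >-> R})
    (X1 : I -> {mfun Omega1 >-> borel X}) (X2 : I -> {mfun Omega2 >-> borel X})
    (P1 P2 : probability (borel X) R)
    (Pt1E : discrete_random_probability mu1 Pt1 J1 X1)
    (Pt2E : discrete_random_probability mu2 Pt2 J2 X2)
    (J1_X1_indep : indep_families mu1 J1 X1)
    (J2_X2_indep : indep_families mu2 J2 X2)
    (X1_iid : iid mu1 X1 P1) (X2_iid : iid mu2 X2 P2)
    (J1_J2_law : same_joint_law mu1 mu2 J1 J2) :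
  W_W (distribution mu1 Pt1) (distribution mu2 Pt2)
    = d_Lip (distribution mu1 Pt1) (distribution mu2 Pt2) /\
  d_Lip (distribution mu1 Pt1) (distribution mu2 Pt2) = W P1 P2.
Proof.
have [M XM] := X_bounded.
have dW := d_Lip_le_W_W XM (distribution mu1 Pt1) (distribution mu2 Pt2).
have WW := W_W_le_W XM X_separable Pt1E Pt2E J1_X1_indep J2_X2_indep X1_iid X2_iid J1_J2_law.
have Wd := W_le_d_Lip XM X_separable Pt1E Pt2E J1_X1_indep J2_X2_indep X1_iid X2_iid.
split; apply/eqP; rewrite eq_le.
  by rewrite dW (le_trans WW).
by rewrite Wd (le_trans dW).
Qed.
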